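(* There is an algorithm that, given a parameter $\epsilon>0$ and sample access to an unknown Bayesian network distribution $P$ on a known directed acyclic graph $G$ on $n$ vertices of in-degree at most $d$, where each variable takes values in a finite alphabet $\Sigma$, returns a Bayesian network $\hat P$ on $G$ such that $d_{TV}(P,\hat P)\le\epsilon$ with probability at least $9/10$. The algorithm takes $m=O(|\Sigma|^{d+1}n\log(|\Sigma|^{d+1}n)\epsilon^{-2})$ samples and runs in $O(|\Sigma|^{d+1}mn)$ time.
   Context: A Bayesian network on a directed acyclic graph $G$ with vertex set $[n]$ is a distribution $P$ of $(X_1,\dots,X_n)$ over $\Sigma^n$ such that for every $i$, $X_i$ is conditionally independent of its non-descendants given its parents in $G$; equivalently $P(x)=\prod_{i=1}^n\Pr_{X\sim P}[X_i=x_i\mid X_j=x_j\ \forall j\in\text{parents}(i)]$. A Bayesian network on $G$ is described by the conditional distributions of each $X_i$ given each assignment to its parents. *)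

(* Defs.v *)
From mathcomp Require Import all_boot all_order all_algebra.
From mathcomp Require Import reals.

Set Implicit Arguments.
Unset Strict Implicit.
Unset Printing Implicit Defensive.

Import Order.TTheory GRing.Theory Num.Theory.

Local Open Scope ring_scope.

Definition is_distr (R : realFieldType) (T : finType) (P : T -> R) : Prop :=
  (forall x, 0 <= P x) /\ \sum_x P x = 1.

Definition prob (R : realFieldType) (T : finType) (P : T -> R) (A : {set T}) : R :=
  \sum_(x in A) P x.

(* When B has probability 0 the value is 0, by x / 0 = 0. *)
Definition cprob (R : realFieldType) (T : finType) (P : T -> R)
    (A B : {set T}) : R :=
  prob P (A :&: B) / prob P B.

Definition dTV (R : realFieldType) (T : finType) (P Q : T -> R) : R :=
  2^-1 * \sum_x `|P x - Q x|.

Definition iid (R : realFieldType) (T : finType) (P : T -> R) (m : nat) :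
    m.-tuple T -> R :=
  fun s => \prod_(k < m) P (tnth s k).

Definition acyclic (T : eqType) (G : rel T) : Prop :=
  forall c : seq T, cycle G c -> c = [::].

(* [G j i] means that there is an edge from j to i. *)
Definition parents (n : nat) (G : rel 'I_n) (i : 'I_n) : {set 'I_n} :=
  [set j | G j i].

(* [connect] is reflexive, so i is not one of its own non-descendants. *)
Definition nondesc (n : nat) (G : rel 'I_n) (i : 'I_n) : {set 'I_n} :=
  [set j | ~~ connect G i j].

Notation assignment n Sigma := {ffun 'I_n -> Sigma}.

(* The event X_S = x_S. *)
Definition cyl (n : nat) (Sigma : finType) (S : {set 'I_n})
    (x : assignment n Sigma) : {set assignment n Sigma} :=
  [set y : assignment n Sigma | [forall j in S, y j == x j]].

(* If the parents have an assignment of probability 0, both sides are 0, so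
   the equation constrains only the conditionings of positive probability. *)
Definition local_markov (R : realFieldType) (n : nat) (Sigma : finType)
    (G : rel 'I_n) (P : assignment n Sigma -> R) : Prop :=
  forall (i : 'I_n) (x : assignment n Sigma),
    cprob P (cyl [set i] x :&: cyl (nondesc G i) x) (cyl (parents G i) x) =
    cprob P (cyl [set i] x) (cyl (parents G i) x) *
    cprob P (cyl (nondesc G i) x) (cyl (parents G i) x).

Definition bayes_net (R : realFieldType) (n : nat) (Sigma : finType)
    (G : rel 'I_n) (P : assignment n Sigma -> R) : Prop :=
  is_distr P /\ local_markov G P.

(* [theta i x a] is the conditional probability of X_i = a when the parents of
   i are assigned as in x. *)
Definition is_cpt (R : realFieldType) (n : nat) (Sigma : finType)
    (theta : 'I_n -> assignment n Sigma -> Sigma -> R) : Prop :=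
  forall i x, is_distr (theta i x).

Definition cpt_law (R : realFieldType) (n : nat) (Sigma : finType)
    (theta : 'I_n -> assignment n Sigma -> Sigma -> R) :
    assignment n Sigma -> R :=
  fun x => \prod_(i < n) theta i x (x i).

(* The machine model is a unit-cost real RAM (no floor function, no conversion
   of a real into an integer) with an instruction that draws a sample. Variables
   and arrays are named by numbers; a program mentions finitely many of them. *)

Inductive nexp : Type :=
| NConst of nat
| NVar of nat
| NGet of nat & nexp
| NAdd of nexp & nexp
| NSub of nexp & nexp
| NMul of nexp & nexp.

Inductive rexp : Type :=
| RNat of nexp
| RVar of nat
| RGet of nat & nexp
| RAdd of rexp & rexp
| RSub of rexp & rexp
| RMul of rexp & rexp
| RDiv of rexp & rexp.

Inductive bexp : Type :=
| BNle of nexp & nexp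
| BRle of rexp & rexp
| BNot of bexp
| BAnd of bexp & bexp.

Inductive cmd : Type :=
| Skip
| NAssign of nat & nexp
| RAssign of nat & rexp
| NPut of nat & nexp & nexp
| RPut of nat & nexp & rexp
| Draw of nat
| Seq of cmd & cmd
| If of bexp & cmd & cmd
| While of bexp & cmd.

(* [src] is the list of the samples that have not been drawn yet. *)
Record state (R : Type) : Type := State {
  nvar : nat -> nat;
  rvar : nat -> R;
  narr : nat -> nat -> nat;
  rarr : nat -> nat -> R;
  src : seq (seq nat) }.

Fixpoint neval (R : Type) (s : state R) (e : nexp) : nat :=
  match e with
  | NConst k => k
  | NVar v => nvar s v
  | NGet a e1 => narr s a (neval s e1)
  | NAdd e1 e2 => (neval s e1 + neval s e2)%N
  | NSub e1 e2 => (neval s e1 - neval s e2)%N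
  | NMul e1 e2 => (neval s e1 * neval s e2)%N
  end.

Fixpoint reval (R : realFieldType) (s : state R) (e : rexp) : R :=
  match e with
  | RNat e1 => (neval s e1)%:R
  | RVar v => rvar s v
  | RGet a e1 => rarr s a (neval s e1)
  | RAdd e1 e2 => reval s e1 + reval s e2
  | RSub e1 e2 => reval s e1 - reval s e2
  | RMul e1 e2 => reval s e1 * reval s e2
  | RDiv e1 e2 => reval s e1 / reval s e2
  end.

Fixpoint beval (R : realFieldType) (s : state R) (e : bexp) : bool :=
  match e with
  | BNle e1 e2 => (neval s e1 <= neval s e2)%N
  | BRle e1 e2 => reval s e1 <= reval s e2
  | BNot e1 => ~~ beval s e1
  | BAnd e1 e2 => beval s e1 && beval s e2
  end.

(* The cost of an evaluation is the number of nodes of the expression. *)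

Fixpoint ncost (e : nexp) : nat :=
  match e with
  | NConst _ | NVar _ => 1
  | NGet _ e1 => (ncost e1).+1
  | NAdd e1 e2 | NSub e1 e2 | NMul e1 e2 => (ncost e1 + ncost e2).+1
  end.

Fixpoint rcost (e : rexp) : nat :=
  match e with
  | RNat e1 => (ncost e1).+1
  | RVar _ => 1
  | RGet _ e1 => (ncost e1).+1
  | RAdd e1 e2 | RSub e1 e2 | RMul e1 e2 | RDiv e1 e2 =>
      (rcost e1 + rcost e2).+1
  end.

Fixpoint bcost (e : bexp) : nat :=
  match e with
  | BNle e1 e2 => (ncost e1 + ncost e2).+1
  | BRle e1 e2 => (rcost e1 + rcost e2).+1
  | BNot e1 => (bcost e1).+1
  | BAnd e1 e2 => (bcost e1 + bcost e2).+1
  end.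

Definition set_nvar (R : Type) (s : state R) (v : nat) (k : nat) : state R :=
  State [eta nvar s with v |-> k] (rvar s) (narr s) (rarr s) (src s).

Definition set_rvar (R : Type) (s : state R) (v : nat) (r : R) : state R :=
  State (nvar s) [eta rvar s with v |-> r] (narr s) (rarr s) (src s).

Definition set_narr (R : Type) (s : state R) (a : nat) (f : nat -> nat) :
    state R :=
  State (nvar s) (rvar s) [eta narr s with a |-> f] (rarr s) (src s).

Definition set_rarr (R : Type) (s : state R) (a : nat) (f : nat -> R) :
    state R :=
  State (nvar s) (rvar s) (narr s) [eta rarr s with a |-> f] (src s).

Definition set_src (R : Type) (s : state R) (l : seq (seq nat)) : state R :=
  State (nvar s) (rvar s) (narr s) (rarr s) l.

(* [exec c s t s']: started in s, c terminates in s' after time t. A draw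
   overwrites the first cells of an array with the coordinates of the next
   sample and is charged for each of them; without samples left it is stuck. *)
Inductive exec (R : realFieldType) :
    cmd -> state R -> nat -> state R -> Prop :=
| ExecSkip s :
    exec Skip s 1 s
| ExecNAssign v e s :
    exec (NAssign v e) s (ncost e).+1 (set_nvar s v (neval s e))
| ExecRAssign v e s :
    exec (RAssign v e) s (rcost e).+1 (set_rvar s v (reval s e))
| ExecNPut a e1 e2 s :
    exec (NPut a e1 e2) s (ncost e1 + ncost e2).+1
      (set_narr s a [eta narr s a with neval s e1 |-> neval s e2])
| ExecRPut a e1 e2 s :
    exec (RPut a e1 e2) s (ncost e1 + rcost e2).+1
      (set_rarr s a [eta rarr s a with neval s e1 |-> reval s e2])
| ExecDraw a s w l :
    src s = w :: l ->
    exec (Draw a) s (size w).+1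
      (set_src (set_narr s a (fun k => nth (narr s a k) w k)) l)
| ExecSeq c1 c2 s1 s2 s3 t1 t2 :
    exec c1 s1 t1 s2 -> exec c2 s2 t2 s3 ->
    exec (Seq c1 c2) s1 (t1 + t2) s3
| ExecIf b c1 c2 s1 s2 t :
    exec (if beval s1 b then c1 else c2) s1 t s2 ->
    exec (If b c1 c2) s1 (bcost b + t).+1 s2
| ExecWhileEnd b c s :
    ~~ beval s b ->
    exec (While b c) s (bcost b).+1 s
| ExecWhileStep b c s1 s2 s3 t1 t2 :
    beval s1 b -> exec c s1 t1 s2 -> exec (While b c) s2 t2 s3 ->
    exec (While b c) s1 (bcost b + t1 + t2).+1 s3.

(* The final state and the running time are functions of the initial state. *)
Lemma exec_det (R : realFieldType) (c : cmd) (s s1 s2 : state R) (t1 t2 : nat) :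
  exec c s t1 s1 -> exec c s t2 s2 -> t1 = t2 /\ s1 = s2.
Proof.
move=> H; elim: H t2 s2 => {c s s1 t1}.
- by move=> s t2 s2 H; inversion H.
- by move=> v e s t2 s2 H; inversion H.
- by move=> v e s t2 s2 H; inversion H.
- by move=> a e1 e2 s t2 s2 H; inversion H.
- by move=> a e1 e2 s t2 s2 H; inversion H.
- move=> a s w l Hs t2 s2 H; inversion H; subst.
  by match goal with E : src s = _ |- _ => move: E end; rewrite Hs => -[-> ->].
- move=> c1 c2 s1 s2 s3 t1 t2 _ IH1 _ IH2 t s H; inversion H; subst.
  match goal with E : exec c1 _ _ _ |- _ => case: (IH1 _ _ E) => ? ? end; subst.
  by match goal with E : exec c2 _ _ _ |- _ => case: (IH2 _ _ E) => -> -> end.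
- move=> b c1 c2 s1 s2 t _ IH t' s H; inversion H; subst.
  by match goal with E : exec _ _ _ _ |- _ => case: (IH _ _ E) => -> -> end.
- move=> b c s Hb t s' H; inversion H; subst=> //.
  by match goal with E : is_true (beval s b) |- _ => rewrite E in Hb end.
- move=> b c s1 s2 s3 t1 t2 Hb _ IH1 _ IH2 t s H; inversion H; subst.
    by match goal with E : is_true (~~ _) |- _ => rewrite Hb in E end.
  match goal with E : exec c _ _ _ |- _ => case: (IH1 _ _ E) => ? ? end; subst.
  by match goal with E : exec (While b c) _ _ _ |- _ => case: (IH2 _ _ E) => -> -> end.
Qed.

(* A symbol is represented by its rank in the alphabet. *)
Definition encode_sample (n : nat) (Sigma : finType) (x : assignment n Sigma) :
    seq nat :=
  [seq nat_of_ord (enum_rank (x i)) | i <- enum 'I_n].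

(* The nat variables 0, 1, 2 hold n, |Sigma|, d and the real variable 0 holds
   eps. The graph is given by adjacency lists: array 0 holds the in-degrees, and
   the k-th parent of i is in cell i * d + k of array 1. All the rest is 0. *)
Definition init (R : realFieldType) (n d : nat) (Sigma : finType) (eps : R)
    (G : rel 'I_n) (samples : seq (assignment n Sigma)) : state R :=
  {| nvar := fun v => nth 0%N [:: n; #|Sigma|; d] v;
     rvar := fun v => nth 0 [:: eps] v;
     narr := fun a k =>
       match a with
       | 0 => if insub k is Some i then #|parents G i| else 0
       | 1 => if insub (k %/ d)%N is Some i
              then nth 0%N [seq nat_of_ord j | j <- enum (parents G i)] (k %% d)
              else 0
       | _ => 0
       end%N;
     rarr := fun _ _ => 0;
     src := [seq encode_sample x | x <- samples] |}.

(* The values in x of the vertices of js, read as base-|Sigma| digits, the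
   least significant one first. *)
Definition code (n : nat) (Sigma : finType) (x : assignment n Sigma)
    (js : seq 'I_n) : nat :=
  foldr (fun j c => enum_rank (x j) + #|Sigma| * c)%N 0%N js.

(* The output is in the real array 0: vertex i owns a block of |Sigma|^(d+1)
   cells, in which |Sigma| consecutive cells are the conditional distribution
   of X_i for one assignment to its parents. *)
Definition output_cpt (R : realFieldType) (n d : nat) (Sigma : finType)
    (G : rel 'I_n) (s : state R) :
    'I_n -> assignment n Sigma -> Sigma -> R :=
  fun i x a =>
    rarr s 0 ((i * #|Sigma| ^ d + code x (enum (parents G i))) * #|Sigma|
              + enum_rank a)%N.

(* Main.v *)
(* Each conditional probability is estimated with add-one smoothing. On the
   support of P the likelihood ratio P x / Phat x is a product of ratios r_i of
   conditional probabilities, so the Hellinger bound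
   dTV^2 <= 2 (1 - sum_x sqrt (P x * Phat x)) and r <= exp (r - 1) give
   dTV^2 <= sum_x P x * sum_i (r_i - 1).
   By size biasing, the expectation of r_i - 1 over the samples is at most
   (|Sigma| - 1) / ((m + 1) * P(X_parents = x_parents)), and averaging over x
   leaves |Sigma|^(d+1) / (m + 1) per vertex. Markov's inequality then allows
   m = ceil (10 |Sigma|^(d+1) n / eps^2), without the logarithm; this m is
   reached by comparing m * eps^2 with 10 |Sigma|^(d+1) n after each draw, so the
   program needs neither a logarithm nor a floor. No sample is drawn when
   eps >= 1 or when the alphabet has a single letter. *)
Require Import Defs.
From mathcomp Require Import all_boot all_order all_algebra.
From mathcomp Require boolp.
From mathcomp Require Import reals sequences exp ring lra zify.

Set Implicit Arguments.
Unset Strict Implicit.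
Unset Printing Implicit Defensive.

Import Order.TTheory GRing.Theory Num.Theory.

Local Open Scope ring_scope.

(** * Bayesian networks on acyclic graphs *)

Section Cylinders.
Variables (n : nat) (Sigma : finType).
Implicit Types (x y z : assignment n Sigma) (S W : {set 'I_n}).

Lemma cylP S x y : reflect {in S, y =1 x} (y \in cyl S x).
Proof. by rewrite inE; apply: (iffP 'forall_in_eqP). Qed.

Lemma cyl_refl S x : x \in cyl S x.
Proof. exact/cylP. Qed.

Lemma cylU S W x : cyl S x :&: cyl W x = cyl (S :|: W) x.
Proof.
apply/setP=> y; rewrite in_setI; apply/andP/cylP => [[/cylP yS /cylP yW] j|ySW].
  by rewrite in_setU => /orP[/yS|/yW].
by split; apply/cylP=> j jS; apply: ySW; rewrite in_setU jS ?orbT.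
Qed.

Lemma cylT x : cyl setT x = [set x].
Proof.
apply/setP=> y; rewrite in_set1; apply/cylP/eqP => [yx|-> //].
by apply/ffunP=> j; apply: yx.
Qed.

Lemma cyl0 x : cyl set0 x = setT.
Proof. by apply/setP=> y; rewrite in_setT; apply/cylP=> j; rewrite in_set0. Qed.

Lemma cyl_eq S x y : y \in cyl S x -> cyl S y = cyl S x.
Proof.
move/cylP=> yx; apply/setP=> z; apply/cylP/cylP => zS j jS; first by rewrite zS ?yx.
by rewrite zS ?yx.
Qed.

Lemma cyl_sub S W x : S \subset W -> cyl W x \subset cyl S x.
Proof.
move/subsetP=> SW; apply/subsetP=> y /cylP yW; apply/cylP=> j /SW; exact: yW.
Qed.

Definition update x (v : 'I_n) (a : Sigma) : assignment n Sigma :=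
  [ffun j => if j == v then a else x j].

Variables (R : realFieldType) (P : assignment n Sigma -> R).

Lemma prob_cylT x : prob P (cyl setT x) = P x.
Proof. by rewrite cylT /prob big_set1. Qed.

(** The assignments that agree with [x] off [W :\: S] list each way of extending [x] from [S] to [W]
    once; [g] sends a point of the large cylinder to its representative. *)
Lemma prob_cyl_marginal S W x : S \subset W ->
  prob P (cyl S x) = \sum_(y in cyl (~: (W :\: S)) x) prob P (cyl W y).
Proof.
move/subsetP=> SW.
pose g z : assignment n Sigma := [ffun j => if j \in W then z j else x j].
rewrite /prob (partition_big g (mem (cyl (~: (W :\: S)) x))) /=; last first.
  move=> z /cylP zS; apply/cylP=> j; rewrite !inE negb_and negbK ffunE.
  by case: ifP => // jW; rewrite orbF => /zS.
apply: eq_bigr => y /cylP yx; apply: eq_bigl => z.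
apply/andP/cylP => [[_ /eqP<-] j jW|zW]; first by rewrite ffunE jW.
split; last first.
  apply/eqP/ffunP=> j; rewrite ffunE; case: ifP => [/zW //|/negbT jW].
  by rewrite yx // !inE negb_and jW orbT.
by apply/cylP=> j jS; rewrite zW ?SW // yx // !inE negb_and jS.
Qed.

Lemma prob_cyl_setU1 S v x : v \notin S ->
  prob P (cyl S x) = \sum_a prob P (cyl (v |: S) (update x v a)).
Proof.
move=> vS; rewrite (@prob_cyl_marginal _ (v |: S)) ?subsetUr //.
rewrite (reindex_onto (update x v) (fun y => y v)) /=; last first.
  move=> y /cylP yx; apply/ffunP=> j; rewrite ffunE; case: eqP => [->//|/eqP jv].
  by rewrite yx // !inE (negbTE jv) /= andNb.
apply: eq_bigl => a; rewrite ffunE !eqxx andbT; apply/cylP=> j.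
by rewrite !inE ffunE; case: eqP => // ->; rewrite vS.
Qed.

End Cylinders.

Lemma prob_setT (R : realFieldType) (T : finType) (P : T -> R) :
  prob P setT = \sum_x P x.
Proof. by apply: eq_bigl => x; rewrite inE. Qed.

Section Nonneg.
Variables (R : realFieldType) (T : finType) (P : T -> R).
Hypothesis P_ge0 : forall x, 0 <= P x.

Lemma prob_ge0 (A : {set T}) : 0 <= prob P A.
Proof. exact: sumr_ge0. Qed.

Lemma le_prob (A B : {set T}) : A \subset B -> prob P A <= prob P B.
Proof.
move=> AB; rewrite [leRHS](big_setID A) /= (setIidPr AB) lerDl.
exact: sumr_ge0.
Qed.

Lemma prob_gt0 (A : {set T}) x : x \in A -> 0 < P x -> 0 < prob P A.
Proof.
move=> xA Px; apply: lt_le_trans Px _.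
by rewrite [leRHS](big_setD1 x) //= lerDl sumr_ge0.
Qed.

End Nonneg.

(** * Ancestral sets of a directed acyclic graph *)

Section Dag.
Variables (n : nat) (G : rel 'I_n).
Hypothesis acyG : acyclic G.
Implicit Types (S : {set 'I_n}).

Definition ancestral S := forall j i, G j i -> i \in S -> j \in S.

Lemma acyclic_edge j i : G j i -> ~~ connect G i j.
Proof.
move=> Gji; apply/connectP=> -[p pth lst].
suff /acyG : cycle G (i :: p) by [].
by rewrite /= rcons_path pth -lst.
Qed.

Lemma ancestral_connect S j i : ancestral S -> connect G j i -> i \in S -> j \in S.
Proof.
move=> anS /connectP[p pth ->]; elim: p j pth => //= k p IH j /andP[Gjk pth] lS.
exact: anS Gjk (IH _ pth lS).
Qed.

Lemma ancestral_sub_nondesc S v : ancestral S -> v \notin S -> S \subset nondesc G v.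
Proof.
move=> anS vS; apply/subsetP=> j jS; rewrite inE; apply: contra vS => vj.
exact: ancestral_connect vj jS.
Qed.

Lemma ancestral_nondesc v : ancestral (nondesc G v).
Proof.
move=> j i Gji; rewrite !inE; apply: contra => vj.
exact: connect_trans vj (connect1 Gji).
Qed.

Lemma notin_nondesc v : v \notin nondesc G v.
Proof. by rewrite inE negbK. Qed.

Lemma parents_sub_nondesc v : parents G v \subset nondesc G v.
Proof. by apply/subsetP=> j; rewrite !inE => /acyclic_edge. Qed.

Lemma notin_parents v : v \notin parents G v.
Proof. exact: contra (subsetP (parents_sub_nondesc v) v) (notin_nondesc v). Qed.

Lemma parents_sub S i : ancestral S -> i \in S -> parents G i \subset S.
Proof. by move=> anS iS; apply/subsetP=> j; rewrite inE => /anS; apply. Qed.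

Lemma ancestral_setU1 S v :
  ancestral S -> parents G v \subset S -> ancestral (v |: S).
Proof.
move=> anS /subsetP paS j i Gji; rewrite !inE => /orP[/eqP iv|/(anS _ _ Gji)->].
  by rewrite paS ?orbT // inE -iv.
by rewrite orbT.
Qed.

(** A vertex outside [S] with the fewest ancestors works: a parent of it outside [S] would have
    strictly fewer, since by acyclicity a vertex is not an ancestor of its own parent. *)
Lemma ancestral_extend S : ancestral S -> S != setT ->
  exists2 v, v \notin S & parents G v \subset S.
Proof.
move=> anS; rewrite -subTset => /subsetPn[v0 _ v0S].
pose w v := #|[set j | connect G j v]|.
case: (@arg_minnP _ v0 (fun v => v \notin S) w v0S) => v vS vmin.
exists v => //; apply/subsetP=> u; rewrite inE => Guv; apply/negPn/negP=> uS.
have := vmin u uS; rewrite leqNgt => /negP; apply; apply: proper_card.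
apply/properP; split.
  by apply/subsetP=> j; rewrite !inE => /connect_trans -> //; apply: connect1.
by exists v; rewrite !inE //; apply: acyclic_edge.
Qed.

(* Visits the vertices in reverse topological order. *)
Lemma ancestral_ind (Q : {set 'I_n} -> Prop) :
  Q setT ->
  (forall S v, ancestral S -> v \notin S -> parents G v \subset S ->
     Q (v |: S) -> Q S) ->
  forall S, ancestral S -> Q S.
Proof.
move=> QT QS S; move: {2}#|~: S| (leqnn #|~: S|) => k.
elim: k S => [|k IH] S cS anS.
  suff -> : S = setT by [].
  by move: cS; rewrite leqn0 cards_eq0 => /eqP/(congr1 (@setC _)); rewrite setCK setC0.
have [-> //|/(ancestral_extend anS)[v vS paS]] := eqVneq S setT.
apply: (QS _ v) => //; apply: IH; last exact: ancestral_setU1.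
by rewrite setCU setIC -setDE -ltnS (leq_trans _ cS) // [leqRHS](cardsD1 v) inE vS.
Qed.

End Dag.

(** * The Markov property and the factorization along the graph *)

Section Markov.
Variables (R : realFieldType) (n : nat) (Sigma : finType) (G : rel 'I_n).
Hypothesis acyG : acyclic G.
Implicit Types (x y : assignment n Sigma) (S : {set 'I_n}).

Section Factorization.
Variable P : assignment n Sigma -> R.
Hypothesis PG : bayes_net G P.

Let P_ge0 : forall x, 0 <= P x. Proof. by case: PG => -[]. Qed.

(** Clearing denominators is safe when the parents have probability 0: every cylinder over a
    superset of them then has probability 0 too. *)
Lemma local_markov_prod v x :
  prob P (cyl (v |: nondesc G v) x) * prob P (cyl (parents G v) x) =
  prob P (cyl (v |: parents G v) x) * prob P (cyl (nondesc G v) x).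
Proof.
have [_ /(_ v x)] := PG; rewrite /cprob !cylU -setUA.
rewrite (setUidPl (parents_sub_nondesc acyG v)).
have [p0 _|p0] := eqVneq (prob P (cyl (parents G v) x)) 0.
  have z S : parents G v \subset S -> prob P (cyl S x) = 0.
    move=> paS; apply/eqP; rewrite eq_le prob_ge0 // andbT -p0.
    exact/le_prob/cyl_sub.
  rewrite (z (v |: parents G v)) ?subsetUr // p0 mulr0 mul0r //.
move/(congr1 ( *%R^~ (prob P (cyl (parents G v) x) ^+ 2))).
rewrite expr2 mulrA divfK // => ->; field; exact: p0.
Qed.

(** Since [S] lies among the non-descendants of [v], this is [local_markov_prod] summed over the
    values on [nondesc G v :\: S], on which the cylinders over the parents do not depend. *)
Lemma ancestral_prob_setU1 S v x : ancestral G S -> v \notin S ->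
  parents G v \subset S ->
  prob P (cyl (v |: S) x) * prob P (cyl (parents G v) x) =
  prob P (cyl (v |: parents G v) x) * prob P (cyl S x).
Proof.
move=> anS vS paS; have SND := ancestral_sub_nondesc anS vS.
have vND := notin_nondesc G v.
rewrite (prob_cyl_marginal P x SND).
rewrite (prob_cyl_marginal P x (setUS [set v] SND)).
have -> : (v |: nondesc G v) :\: (v |: S) = nondesc G v :\: S.
  apply/setP=> j; rewrite !in_setD !in_setU1; case: eqP => //= ->.
  by rewrite (negbTE vND) andbF.
rewrite mulr_suml mulr_sumr; apply: eq_bigr => y yx.
have sub (W : {set 'I_n}) : W \subset v |: S -> cyl W y = cyl W x.
  move=> /subsetP WS; apply: cyl_eq; apply/cylP=> j /WS jS; apply: (cylP _ _ _ yx).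
  move: jS; rewrite !inE negb_and negbK => /orP[/eqP ->|->//].
  by rewrite connect0 orbT.
rewrite -(sub (parents G v)) ?(subset_trans paS) ?subsetUr //.
by rewrite -(sub (v |: parents G v)) ?setUS // local_markov_prod.
Qed.

(** The probability of an ancestral cylinder gains one factor with each vertex added in topological
    order. On the support of [P] all denominators are positive. *)
Lemma bayes_net_factor x : 0 < P x ->
  P x = \prod_i (prob P (cyl (i |: parents G i) x) / prob P (cyl (parents G i) x)).
Proof.
move=> Px.
pose c i := prob P (cyl (i |: parents G i) x) / prob P (cyl (parents G i) x).
rewrite -[RHS]/(\prod_i c i).
have pos S : 0 < prob P (cyl S x) by apply: prob_gt0 Px => //; apply: cyl_refl.
suff /(_ set0) : forall S, ancestral G S ->
    P x = prob P (cyl S x) * \prod_(i in ~: S) c i.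
  rewrite cyl0 setC0 => ->; last by move=> j i; rewrite !inE.
  rewrite prob_setT; case: PG => -[_ ->] _; rewrite mul1r.
  by apply: eq_bigl => i; rewrite inE.
apply: (ancestral_ind acyG) => [|S v anS vS paS ->].
  by rewrite prob_cylT setCT big_set0 mulr1.
rewrite [in RHS](big_setD1 v) ?inE //= mulrA setCU setIC -setDE; congr (_ * _).
rewrite /c mulrA [X in X / _]mulrC -ancestral_prob_setU1 // mulfK //.
by rewrite gt_eqF.
Qed.

End Factorization.

Section Cpt.
Variable theta : 'I_n -> assignment n Sigma -> Sigma -> R.
Hypothesis theta_cpt : is_cpt theta.
Hypothesis theta_loc : forall i x y a,
  y \in cyl (parents G i) x -> theta i y a = theta i x a.

(** Vertices are summed out in reverse topological order. The removed vertex is a parent of no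
    vertex of the ancestral set that remains, so its value enters only its own factor, which sums to
    1. *)
Lemma cpt_law_ancestral S : ancestral G S -> forall x,
  prob (cpt_law theta) (cyl S x) = \prod_(i in S) theta i x (x i).
Proof.
elim/(ancestral_ind acyG): S / => [x|S v anS vS paS IH x].
  by rewrite prob_cylT; apply: eq_bigl => i; rewrite inE.
rewrite (prob_cyl_setU1 _ _ vS).
transitivity (\sum_a theta v x a * \prod_(i in S) theta i x (x i)).
  apply: eq_bigr => a _; rewrite IH (big_setU1 _ vS) /= ffunE eqxx.
  have loc i : v \notin parents G i ->
      theta i (update x v a) =1 theta i x.
    move=> vi b; apply: theta_loc; apply/cylP=> j ji.
    by rewrite ffunE; case: eqP => // jv; rewrite -jv ji in vi.
  rewrite loc ?notin_parents //; congr (_ * _); apply: eq_bigr => i iS.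
  rewrite loc; last by apply: contra vS; apply/subsetP/parents_sub.
  by rewrite ffunE; case: eqP => // iv; rewrite -iv iS in vS.
by rewrite -mulr_suml; case: (theta_cpt v x) => _ ->; rewrite mul1r.
Qed.

(** The point [x0] excludes an empty space, over which the total mass would be 0. *)
Lemma bayes_net_cpt_law (x0 : assignment n Sigma) : bayes_net G (cpt_law theta).
Proof.
split; first split.
- by move=> x; apply: prodr_ge0 => i _; case: (theta_cpt i x).
- have := @cpt_law_ancestral set0; rewrite -prob_setT -(cyl0 x0) => ->.
    by rewrite big_set0.
  by move=> j i; rewrite !inE.
move=> v x.
(* The factor of [v] splits off for every [S] between the parents and the non-descendants; the two
   extreme choices of [S] give the Markov equation. *)
have fac S : parents G v \subset S -> S \subset nondesc G v ->
    prob (cpt_law theta) (cyl (v |: S) x) =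
    theta v x (x v) * prob (cpt_law theta) (cyl S x).
  move=> paS SND; have vND := notin_nondesc G v.
  rewrite (prob_cyl_marginal _ x SND).
  rewrite (prob_cyl_marginal _ x (setUS [set v] SND)).
  have -> : (v |: nondesc G v) :\: (v |: S) = nondesc G v :\: S.
    apply/setP=> j; rewrite !in_setD !in_setU1; case: eqP => //= ->.
    by rewrite (negbTE vND) andbF.
  rewrite mulr_sumr; apply: eq_bigr => y /cylP yx.
  have paND := parents_sub_nondesc acyG v.
  have anND := @ancestral_nondesc _ G v.
  rewrite !cpt_law_ancestral //; last exact: ancestral_setU1.
  rewrite big_setU1 //= yx ?in_setC ?in_setD ?(negbTE vND) ?andbF //.
  congr (_ * _); apply: theta_loc; apply/cylP=> j jpa; apply: yx.
  by rewrite !inE negb_and negbK (subsetP paS).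
rewrite /cprob !cylU -setUA (setUidPl (parents_sub_nondesc acyG v)).
rewrite !fac ?parents_sub_nondesc //.
have [->|p0] := eqVneq (prob (cpt_law theta) (cyl (parents G v) x)) 0.
  by rewrite invr0 !mulr0.
by rewrite mulfK // mulrA.
Qed.

End Cpt.

End Markov.

(** * Add-one smoothing *)

Section IidExpectation.
Variables (R : realFieldType) (T : finType) (P : T -> R).
Implicit Types (f g : seq T -> R) (m : nat).

(** The iterated sum, with [f] defined on sequences of any length, lets inductions peel off the
    first draw without handling tuples. *)
Fixpoint expect m f : R :=
  if m is m'.+1 then \sum_x P x * expect m' (fun s => f (x :: s)) else f [::].

Lemma expect_iid m f :
  \sum_(s : m.-tuple T) iid P s * f s = expect m f.
Proof.
elim: m f => [|m IH] f /=.
  rewrite (big_pred1 [tuple]) => [|s]; last exact/esym/eqP/tuple0.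
  by rewrite /iid big_ord0 mul1r.
pose h (p : T * m.-tuple T) := [tuple of p.1 :: p.2].
rewrite (reindex h) /=; last first.
  exists (fun s : m.+1.-tuple T => (thead s, [tuple of behead s])).
    by move=> [x s] _; congr pair; apply: val_inj.
  by move=> s _; rewrite /h /= -tuple_eta.
transitivity (\sum_x \sum_(s : m.-tuple T) iid P (h (x, s)) * f (h (x, s))).
  by rewrite pair_big; apply: eq_bigr => -[].
apply: eq_bigr => x _; rewrite -IH mulr_sumr; apply: eq_bigr => s _.
rewrite mulrA /iid big_ord_recl tnth0; congr (_ * _ * _).
by apply: eq_bigr => k _; rewrite tnthS.
Qed.

Lemma eq_expect m f g : f =1 g -> expect m f = expect m g.
Proof.
elim: m f g => [|m IH] f g fg /=; first exact: fg.
by apply: eq_bigr => x _; congr (_ * _); apply: IH => s.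
Qed.

Lemma expectD m f g :
  expect m (fun s => f s + g s) = expect m f + expect m g.
Proof.
elim: m f g => [//|m IH] f g /=.
by rewrite -big_split; apply: eq_bigr => x _; rewrite IH mulrDr.
Qed.

Lemma expectZ m c f : expect m (fun s => c * f s) = c * expect m f.
Proof.
elim: m f => [//|m IH] f /=.
by rewrite mulr_sumr; apply: eq_bigr => x _; rewrite IH mulrCA.
Qed.

Lemma expect_sum m (I : finType) (F : I -> seq T -> R) :
  expect m (fun s => \sum_i F i s) = \sum_i expect m (F i).
Proof.
elim: m F => [//|m IH] F /=.
rewrite exchange_big; apply: eq_bigr => x _.
by rewrite (IH (fun i s => F i (x :: s))) mulr_sumr.
Qed.

Hypothesis distrP : is_distr P.

Lemma expect_cst m c : expect m (fun=> c) = c.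
Proof.
by elim: m => //= m IH; rewrite IH -mulr_suml; case: distrP => _ ->; rewrite mul1r.
Qed.

Lemma le_expect m f g : (forall s, f s <= g s) -> expect m f <= expect m g.
Proof.
elim: m f g => [|m IH] f g fg /=; first exact: fg.
by apply: ler_sum => x _; apply: ler_wpM2l; [case: distrP | apply: IH].
Qed.

(* Size biasing: the summand of [count C] that belongs to one draw says that
   this draw lies in C, and by symmetry it may be taken to be the first. *)
Lemma expect_count m (C : pred T) f :
  (forall s t, perm_eq s t -> f s = f t) ->
  expect m (fun s => (count C s)%:R * f s) =
  m%:R * \sum_(x | C x) P x * expect m.-1 (fun s => f (x :: s)).
Proof.
elim: m f => [|m IH] f fperm /=; first by rewrite !mul0r.
(* Conditioning on the first draw: either it is counted itself, or the count comes from the other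
   [m] draws, to which the induction hypothesis applies. *)
transitivity (\sum_(x | C x) P x * expect m (fun s => f (x :: s)) +
    m%:R * \sum_x P x * \sum_(y | C y) P y * expect m.-1 (fun s => f (x :: y :: s))).
  rewrite [X in _ = X + _]big_mkcond [X in _ = _ + X]mulr_sumr -big_split.
  apply: eq_bigr => x _ /=.
  rewrite [m%:R * _]mulrCA -(IH (fun s => f (x :: s))); last first.
    by move=> s t st; apply: fperm; rewrite perm_cons.
  rewrite (@eq_expect m _ (fun s => (C x)%:R * f (x :: s) +
       (count C s)%:R * f (x :: s))); last by move=> s; rewrite natrD mulrDl.
  by rewrite expectD expectZ mulrDr; case: (C x); rewrite ?mul1r ?mul0r ?mulr0.
rewrite -[m.+1%:R]natr1 mulrDl mul1r addrC; congr (_ + _).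
(* For [m = 0] the factor [m%:R] removes the term in which [m.-1] is not a predecessor. Otherwise
   the biased draw [y] is exchanged with the first draw [x]. *)
case: m {IH} => [|m]; first by rewrite !mul0r.
congr (_ * _); under eq_bigr do rewrite mulr_sumr.
rewrite exchange_big; apply: eq_bigr => y _ /=; rewrite mulr_sumr.
apply: eq_bigr => x _; rewrite mulrCA; congr (_ * (_ * _)).
by apply: eq_expect => s; apply: fperm; rewrite -cat1s -[_ :: s]cat1s perm_catCA.
Qed.

(** Size biasing over [m.+1] draws, with the inverse count as [f]: the biased draw lies in [A] and
    replaces the count by its successor, while the count divided by itself is at most 1, being 0 if
    nothing is counted. *)
Lemma expect_inv_count m (A : pred T) (a := \sum_(x | A x) P x) : 0 < a ->
  expect m (fun s => (count A s).+1%:R^-1) <= (m.+1%:R * a)^-1.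
Proof.
move=> a0; rewrite -[leRHS]div1r ler_pdivlMr ?mulr_gt0 //.
have := @expect_count m.+1 A (fun s => (count A s)%:R^-1).
move=> /(_ (fun s t st => congr1 (fun k => k%:R^-1) (permP st A))) E.
apply: (@le_trans _ _ (expect m.+1 (fun s => (count A s)%:R / (count A s)%:R))).
  rewrite E mulrCA; apply: ler_wpM2l => //; rewrite /a mulr_sumr.
  rewrite le_eqVlt; apply/orP; left; apply/eqP/eq_bigr => x Ax.
  by rewrite mulrC; congr (_ * _); apply: eq_expect => s; rewrite /= Ax.
rewrite -[leRHS](expect_cst m.+1); apply: le_expect => s.
by have [->|c0] := eqVneq (count A s) 0%N; rewrite ?mul0r // mulfV ?pnatr_eq0.
Qed.

(** With [C] the part of [B] outside [A], the ratio is 1 plus [(count C + k - 1) / (count A + 1)]. A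
    size-biased draw from [C] leaves the count of [A] unchanged, so [expect_inv_count] bounds both
    terms. *)
Lemma expect_smoothed_ratio m k (A B : pred T)
    (a := \sum_(x | A x) P x) (b := \sum_(x | B x) P x) :
  0 < a -> subpred A B -> (0 < k)%N ->
  expect m (fun s => (count B s + k)%:R / (count A s).+1%:R) <=
  b / a + (k.-1)%:R / (m.+1%:R * a).
Proof.
move=> a0 AB k0; pose C := predD B A; pose g s : R := (count A s).+1%:R^-1.
have bE : b = a + \sum_(x | C x) P x.
  rewrite /b (bigID A) /=; congr (_ + _); last by apply: eq_bigl => x; rewrite andbC.
  by apply: eq_bigl => x; case: (boolP (A x)) => [/AB ->|]; rewrite ?andbF.
have cntE s : (count B s = count A s + count C s)%N.
  elim: s => //= x s ->.
  have : nat_of_bool (B x) = (A x + C x)%N.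
    by rewrite /C /=; case: (boolP (A x)) => [/AB|] ; [case: (B x)|rewrite add0n].
  lia.
rewrite (@eq_expect m _ (fun s => 1 + ((count C s)%:R * g s + k.-1%:R * g s))).
  rewrite !expectD expect_cst expectZ bE mulrDl divff ?gt_eqF // -addrA lerD2l.
  apply: lerD; last by apply: ler_wpM2l => //; apply: expect_inv_count.
  rewrite expect_count => [|s t /permP cst]; last by rewrite /g cst.
  rewrite (eq_bigr (fun x => P x * expect m.-1 g)); last first.
    move=> x /andP[/= nAx _]; congr (_ * _).
    by apply: eq_expect => s; rewrite /g /= (negbTE nAx).
  rewrite -mulr_suml mulrCA; apply: ler_wpM2l.
    by apply: sumr_ge0 => x _; case: distrP.
  case: m => [|m]; first by rewrite mul0r invr_ge0 ltW.
  rewrite -ler_pdivlMl // -invfM; exact: expect_inv_count.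
move=> s; rewrite /g cntE -[k in LHS]prednK // !natrD -!natr1.
by field; rewrite natr1 pnatr_eq0.
Qed.

End IidExpectation.

(** * Total variation, Hellinger affinity and likelihood ratios *)

Section TotalVariation.

(** By Lagrange's identity, twice the difference of the two sides is a double sum of squares. *)
Lemma sum_cauchy_schwarz (R : realFieldType) (I : finType) (f g : I -> R) :
  (\sum_i f i * g i) ^+ 2 <= (\sum_i f i ^+ 2) * (\sum_i g i ^+ 2).
Proof.
have : 0 <= \sum_i \sum_j (f i * g j - f j * g i) ^+ 2.
  by apply: sumr_ge0 => i _; apply: sumr_ge0 => j _; apply: sqr_ge0.
set F := \sum_i f i ^+ 2; set H := \sum_i g i ^+ 2; set M := \sum_i f i * g i.
have -> : \sum_i \sum_j (f i * g j - f j * g i) ^+ 2 = 2 * (F * H - M ^+ 2).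
  transitivity (\sum_i (f i ^+ 2 * H + g i ^+ 2 * F - 2 * (f i * g i) * M)).
    apply: eq_bigr => i _; rewrite /F /H /M !mulr_sumr -sumrN -!big_split.
    by apply: eq_bigr => j _ /=; ring.
  rewrite !big_split sumrN -!mulr_suml -mulr_sumr -/F -/H -/M /=; ring.
by rewrite pmulr_rge0 // subr_ge0.
Qed.

Lemma dTV_le1 (R : realFieldType) (T : finType) (P Q : T -> R) :
  is_distr P -> is_distr Q -> dTV P Q <= 1.
Proof.
move=> [P0 P1] [Q0 Q1]; rewrite /dTV ler_pdivrMl // mulr1.
apply: le_trans (_ : \sum_x (P x + Q x) <= _); last by rewrite big_split P1 Q1.
apply: ler_sum => x _; apply: le_trans (ler_normB _ _) _.
by rewrite !ger0_norm.
Qed.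

Variables (R : realType) (T : finType) (P Q : T -> R).
Hypotheses (distrP : is_distr P) (distrQ : is_distr Q).

(** With [u] and [v] the square roots of [P] and [Q], [|P - Q| = |u - v| (u + v)], and
    Cauchy-Schwarz gives [dTV^2 <= (1 - B) (1 + B)], where the affinity [B] is at most 1. *)
Lemma dTV_sqr_affinity :
  dTV P Q ^+ 2 <= 2 * (1 - \sum_x Num.sqrt (P x * Q x)).
Proof.
case: distrP distrQ => P0 P1 [Q0 Q1]; set B := \sum_x _.
pose u x := Num.sqrt (P x); pose v x := Num.sqrt (Q x).
have uE x : u x ^+ 2 = P x by rewrite sqr_sqrtr.
have vE x : v x ^+ 2 = Q x by rewrite sqr_sqrtr.
have uvE x : Num.sqrt (P x * Q x) = u x * v x by rewrite sqrtrM.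
have minusE : \sum_x (`|u x - v x|) ^+ 2 = 2 - 2 * B.
  transitivity (\sum_x (P x + Q x - 2 * Num.sqrt (P x * Q x))).
    by apply: eq_bigr => x _; rewrite real_normK ?num_real // uvE -uE -vE; ring.
  rewrite !big_split sumrN -mulr_sumr P1 Q1 -/B /=; ring.
have plusE : \sum_x (u x + v x) ^+ 2 = 2 + 2 * B.
  transitivity (\sum_x (P x + Q x + 2 * Num.sqrt (P x * Q x))).
    by apply: eq_bigr => x _; rewrite uvE -uE -vE; ring.
  rewrite !big_split -mulr_sumr P1 Q1 -/B /=; ring.
have B1 : B <= 1.
  have : 0 <= 2 - 2 * B by rewrite -minusE; apply: sumr_ge0 => x _; apply: sqr_ge0.
  by lra.
have := sum_cauchy_schwarz (fun x => `|u x - v x|) (fun x => u x + v x).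
rewrite minusE plusE /dTV exprMn.
have -> : \sum_x `|u x - v x| * (u x + v x) = \sum_x `|P x - Q x|.
  apply: eq_bigr => x _; rewrite -[X in _ * X]ger0_norm ?addr_ge0 ?sqrtr_ge0 //.
  by rewrite -normrM -subr_sqr uE vE.
set S := (\sum_x _) ^+ 2 => SB; nra.
Qed.

(* Subadditivity over the factors: the likelihood ratio P x / Q x is a product
   of ratios r_i <= exp (r_i - 1). *)
Lemma dTV_sqr_product (I : finType) (p q : I -> T -> R) :
  (forall x, 0 < P x -> P x = \prod_i p i x) ->
  (forall x, Q x = \prod_i q i x) ->
  (forall i x, 0 < P x -> 0 < p i x) -> (forall i x, 0 < q i x) ->
  dTV P Q ^+ 2 <= \sum_x P x * \sum_i (p i x / q i x - 1).
Proof.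
move=> PE QE p0 q0; apply: le_trans dTV_sqr_affinity _.
case: distrP => P0 P1; set u := fun x => \sum_i (p i x / q i x - 1).
(* On the support of [P], [sqrt (P x * Q x) >= P x * exp (- u x / 2) >= P x * (1 - u x / 2)],
   because [u x] bounds the logarithm of the likelihood ratio. *)
suff sqrt_ge x : P x - P x * u x / 2 <= Num.sqrt (P x * Q x).
  have : \sum_x (P x - P x * u x / 2) <= \sum_x Num.sqrt (P x * Q x).
    exact: ler_sum.
  rewrite big_split sumrN -mulr_suml P1 /=; lra.
have [Px|] := boolP (0 < P x); last first.
  by rewrite lt0r P0 andbT negbK => /eqP->; rewrite !mul0r subr0 sqrtr_ge0.
have ratio : P x / Q x <= expR (u x).
  rewrite QE PE // -prodf_div expR_sum; apply: ler_prod => i _.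
  apply/andP; split; first by rewrite divr_ge0 // ltW ?p0.
  by rewrite -[leLHS](subrK 1) addrC expR_ge1Dx.
have Qx : 0 < Q x by rewrite QE prodr_gt0.
have half : expR (- (u x / 2)) ^+ 2 <= Q x / P x.
  rewrite -expRM_natl (_ : 2%:R * _ = - u x); last by field.
  rewrite expRN -[leRHS]invf_div.
  by rewrite lef_pV2 // posrE ?expR_gt0 ?divr_gt0.
apply: (@le_trans _ _ (P x * expR (- (u x / 2)))).
  rewrite -mulrA -[X in X - _]mulr1 -mulrBr ler_pM2l //.
  exact: expR_ge1Dx.
rewrite -[leLHS]ger0_norm ?mulr_ge0 ?expR_ge0 // -sqrtr_sqr ler_sqrt; last first.
  by rewrite mulr_ge0 // ltW.
by rewrite exprMn [P x ^+ 2]expr2 -mulrA ler_pM2l // -ler_pdivlMl // [leRHS]mulrC.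
Qed.

End TotalVariation.

(** * Numbering the assignments of a set of vertices *)

Section Code.
Variables (n : nat) (Sigma : finType).
Implicit Types (x y : assignment n Sigma) (js : seq 'I_n).

Lemma code_lt x js : (code x js < #|Sigma| ^ size js)%N.
Proof.
elim: js => [//|j js IH] /=; rewrite expnS.
apply: (@leq_trans (#|Sigma| * (code x js).+1)).
  by rewrite mulnS ltn_add2r ltn_ord.
by rewrite leq_mul2l IH orbT.
Qed.

Lemma eq_code x y js : {in js, x =1 y} -> code x js = code y js.
Proof.
elim: js => [//|j js IH] xy /=; rewrite xy ?mem_head // IH // => i ijs.
by apply: xy; rewrite inE ijs orbT.
Qed.

Lemma code_inj x y js : code x js = code y js -> {in js, x =1 y}.
Proof.
elim: js => [//|j js IH] /= xy.
have xj := ltn_ord (enum_rank (x j)); have yj := ltn_ord (enum_rank (y j)).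
have S0 := leq_ltn_trans (leq0n _) xj.
have xyj : x j = y j.
  apply/enum_rank_inj/val_inj; have := congr1 (modn^~ #|Sigma|) xy.
  rewrite /= ![(#|Sigma| * _)%N]mulnC ![(enum_rank _ + _)%N]addnC !modnMDl.
  by rewrite !modn_small.
move: xy; rewrite xyj => /addnI/eqP; rewrite eqn_pmul2l // => /eqP/IH xy i.
by rewrite inE => /orP[/eqP->|/xy].
Qed.

Lemma code_cyl (S : {set 'I_n}) x y :
  (code y (enum S) == code x (enum S)) = (y \in cyl S x).
Proof.
apply/eqP/cylP => [/code_inj yx j jS|yx]; first by rewrite yx ?mem_enum.
by apply: eq_code => j; rewrite mem_enum => /yx.
Qed.

(** Grouping the [x] by their code on [S] gives at most [#|Sigma| ^ #|S|] groups. Each contributes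
    1, or 0 when its cylinder has probability 0. *)
Lemma sum_div_prob_cyl (R : realFieldType) (P : assignment n Sigma -> R)
    (S : {set 'I_n}) : is_distr P ->
  \sum_x P x / prob P (cyl S x) <= (#|Sigma| ^ #|S|)%:R.
Proof.
move=> [P0 _]; have lt x := code_lt x (enum S).
rewrite -(card_ord (_ ^ _)) -sumr_const cardE.
rewrite (partition_big (fun x => Ordinal (lt x)) predT) //=.
apply: ler_sum => c _.
case: (pickP (fun x => Ordinal (lt x) == c)) => [x0 /eqP<-|none]; last first.
  by rewrite big_pred0.
rewrite (eq_bigl (mem (cyl S x0))); last first.
  by move=> x; rewrite -[RHS]/(x \in cyl S x0) -code_cyl.
rewrite (eq_bigr (fun x => P x / prob P (cyl S x0))); last first.
  by move=> x /cyl_eq->.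
rewrite -mulr_suml -/(prob P _).
by have [->|p0] := eqVneq (prob P (cyl S x0)) 0; rewrite ?mul0r // divff.
Qed.

End Code.

(** * Accuracy of the add-one estimator *)

Section Laplace.
Variables (R : realType) (n : nat) (Sigma : finType) (G : rel 'I_n).
Implicit Types (s : seq (assignment n Sigma)) (x y : assignment n Sigma).

(** Smoothing keeps every estimate positive, so likelihood ratios against it are finite, and yields
    the uniform distribution for parent assignments that never occur in [s]. *)
Definition laplace s (i : 'I_n) x (a : Sigma) : R :=
  (count (fun y => (y \in cyl (parents G i) x) && (y i == a)) s).+1%:R /
  (count (mem (cyl (parents G i) x)) s + #|Sigma|)%:R.

Lemma card_alphabet_gt0 x (i : 'I_n) : (0 < #|Sigma|)%N.
Proof. by apply/card_gt0P; exists (x i). Qed.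

Lemma laplace_gt0 s i x a : 0 < laplace s i x a.
Proof.
by rewrite divr_gt0 // ltr0n addn_gt0 (card_alphabet_gt0 x i) orbT.
Qed.

Lemma laplace_cpt s : is_cpt (laplace s).
Proof.
move=> i x; split=> [a|]; first exact/ltW/laplace_gt0.
rewrite -mulr_suml -natr_sum; set B := mem _.
have -> : (\sum_a (count (fun y => (B y) && (y i == a)) s).+1 =
    count B s + #|Sigma|)%N.
  under eq_bigr do rewrite -addn1.
  rewrite big_split /= sum1_card; congr (_ + _)%N.
  (* A sample that matches the parents is counted for exactly one letter. *)
  elim: s => [|y s IH] /=; first by rewrite big1.
  rewrite big_split /= IH; congr (_ + _)%N.
  case: (in_mem y B); last by rewrite big1.
  by rewrite (bigD1 (y i)) //= eqxx big1 // => a; rewrite eq_sym => /negbTE->.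
by rewrite divff // pnatr_eq0 -lt0n addn_gt0 (card_alphabet_gt0 x i) orbT.
Qed.

Lemma laplace_local s i x y a :
  y \in cyl (parents G i) x -> laplace s i y a = laplace s i x a.
Proof. by rewrite /laplace => /cyl_eq->. Qed.

Hypothesis acyG : acyclic G.

Lemma laplace_bayes_net s x : bayes_net G (cpt_law (laplace s)).
Proof.
by apply: bayes_net_cpt_law x => //; [apply: laplace_cpt | apply: laplace_local].
Qed.

Variable P : assignment n Sigma -> R.
Hypothesis PG : bayes_net G P.

Let distrP : is_distr P. Proof. by case: PG. Qed.

Lemma distr_inhabited : inhabited (assignment n Sigma).
Proof.
case: (pickP (@predT (assignment n Sigma))) => [x _|none]; first by exists.
by have [_] := distrP; rewrite big_pred0 // => /esym/eqP; rewrite oner_eq0.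
Qed.

Lemma expect_dTV_laplace m :
  expect P m (fun s => dTV P (cpt_law (laplace s)) ^+ 2) <=
  #|Sigma|.-1%:R / m.+1%:R * \sum_i (#|Sigma| ^ #|parents G i|)%:R.
Proof.
have [P0 _] := distrP; have [x0] := distr_inhabited.
pose b i x := prob P (cyl (parents G i) x).
pose a i x := prob P (cyl (i |: parents G i) x).
have pos S x : 0 < P x -> 0 < prob P (cyl S x).
  by move=> Px; apply: prob_gt0 Px => //; apply: cyl_refl.
apply: (@le_trans _ _ (expect P m (fun s =>
   \sum_x P x * \sum_i (a i x / b i x / laplace s i x (x i) - 1)))).
  apply: le_expect => // s; have [distrQ _] := laplace_bayes_net s x0.
  apply: dTV_sqr_product => // [x|i x Px|i x].
  - exact: bayes_net_factor.
  - by rewrite divr_gt0 ?pos.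
  - exact: laplace_gt0.
rewrite expect_sum.
apply: (@le_trans _ _ (\sum_x P x * \sum_i (#|Sigma|.-1%:R / m.+1%:R / b i x))).
  apply: ler_sum => x _; rewrite expectZ expect_sum.
  have [Px|] := boolP (0 < P x); last first.
    by rewrite lt0r P0 andbT negbK => /eqP->; rewrite !mul0r.
  apply: ler_wpM2l => //; apply: ler_sum => i _.
  pose B := mem (cyl (parents G i) x).
  pose A y := (y \in cyl (parents G i) x) && (y i == x i).
  rewrite expectD expect_cst // lerBlDr.
  rewrite (@eq_expect _ _ _ _ _ (fun s => a i x / b i x *
     ((count B s + #|Sigma|)%:R / (count A s).+1%:R))); last first.
    by move=> s; rewrite /laplace invf_div.
  have aE : \sum_(y | A y) P y = a i x.
    apply: eq_bigl => y; rewrite /A setUC -cylU in_setI; congr (_ && _).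
    apply/eqP/cylP => [yx j|->//]; last by rewrite inE.
    by rewrite inE => /eqP->.
  have bE : \sum_(y | B y) P y = b i x by apply: eq_bigl.
  have ai : 0 < a i x by apply: pos.
  have bi : 0 < b i x by apply: pos.
  (* Multiplied by [a i x / b i x], this bounds the expected ratio by
     [1 + (k - 1) / ((m + 1) * b i x)], with [k] the size of the alphabet. *)
  have := @expect_smoothed_ratio _ _ _ distrP m #|Sigma| A B.
  rewrite aE bE => /(_ ai _ (card_alphabet_gt0 x i)) H.
  rewrite expectZ -ler_pdivlMl ?divr_gt0 //.
  apply: le_trans (H _) _; first by move=> y /andP[].
  rewrite le_eqVlt; apply/orP; left; apply/eqP; field.
  by rewrite !gt_eqF // addrC natr1.
(* For a fixed vertex, the sum of [P x / b i x] over [x] is at most the number of assignments to its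
   parents. *)
under eq_bigr do rewrite mulr_sumr.
rewrite exchange_big mulr_sumr; apply: ler_sum => i _.
under eq_bigr do rewrite mulrCA.
rewrite -mulr_sumr; apply: ler_wpM2l; first by rewrite divr_ge0.
exact: sum_div_prob_cyl.
Qed.

Lemma iid_ge0 m (s : m.-tuple (assignment n Sigma)) : 0 <= iid P s.
Proof. by apply: prodr_ge0 => k _; case: distrP. Qed.

(** The alternatives are the situations in which no further draw is called for: enough samples, at
    most one letter, where the bound on the expectation has the factor [#|Sigma|.-1 = 0], or an
    [eps] that no total variation distance exceeds. *)
Lemma laplace_accuracy m d (eps : R) : 0 < eps ->
  (forall i, (#|parents G i| <= d)%N) ->
  10 * (#|Sigma| ^ d.+1 * n)%:R <= m%:R * eps ^+ 2 \/
    (#|Sigma| <= 1)%N \/ 1 <= eps ->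
  9 / 10 <= prob (iid P (m := m))
    [set s : m.-tuple (assignment n Sigma) | dTV P (cpt_law (laplace s)) <= eps].
Proof.
move=> eps0 pad cases; have [x0] := distr_inhabited.
set good := [set s | _].
have total : prob (iid P (m := m)) setT = 1.
  rewrite prob_setT -[RHS](expect_cst distrP m) -expect_iid.
  by apply: eq_bigr => s _; rewrite mulr1.
have [eps1|eps1] := leP 1 eps.
  suff -> : good = setT by rewrite total; lra.
  apply/setP=> s; rewrite !inE; apply: le_trans eps1.
  by apply: dTV_le1 => //; case: (laplace_bayes_net s x0).
have split : prob (iid P (m := m)) good + prob (iid P (m := m)) (~: good) = 1.
  by rewrite -total [RHS](big_setID good) /= setTI setTD.
(* Markov's inequality for the squared distance, whose mean is shown to be at most
   [eps ^+ 2 / 10]. *)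
suff : prob (iid P (m := m)) (~: good) * eps ^+ 2 <= eps ^+ 2 / 10.
  by rewrite ler_pdivlMr // mulrAC ger_pMl ?exprn_gt0 //; lra.
apply: le_trans (_ : expect P m (fun s => dTV P (cpt_law (laplace s)) ^+ 2) <= _).
  rewrite -expect_iid [leRHS](bigID (mem (~: good))) /= mulr_suml.
  rewrite -[leLHS]addr0; apply: lerD; last first.
    by apply: sumr_ge0 => s _; rewrite mulr_ge0 ?iid_ge0 ?sqr_ge0.
  apply: ler_sum => s; rewrite !inE -ltNge => far.
  by apply: ler_wpM2l; rewrite ?iid_ge0 // ler_sqr ?nnegrE ?ltW // (lt_trans eps0).
apply: le_trans (expect_dTV_laplace m) _.
have sumK : \sum_i (#|Sigma| ^ #|parents G i|)%:R <= (#|Sigma| ^ d * n)%:R :> R.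
  rewrite -natr_sum ler_nat mulnC -[X in (_ <= X * _)%N]card_ord -sum_nat_const.
  apply: leq_sum => i _; have S0 := card_alphabet_gt0 x0 i.
  by rewrite leq_pexp2l.
case: cases => [large|[small|]]; last 2 first.
- have -> : #|Sigma|.-1 = 0%N by lia.
  by rewrite !mul0r divr_ge0 // sqr_ge0.
- by rewrite leNgt eps1.
rewrite mulrAC ler_pdivrMr //.
apply: le_trans (_ : (#|Sigma| ^ d.+1 * n)%:R <= _).
  rewrite expnS -mulnA natrM; apply: ler_pM => //; first exact: sumr_ge0.
  by rewrite ler_nat leq_pred.
have e2 : 0 < eps ^+ 2 by rewrite exprn_gt0.
rewrite -[m.+1%:R]natr1; lra.
Qed.

End Laplace.

(** * The program *)

Section Wp.
Variable R : realFieldType.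
Implicit Types (c : cmd) (s : state R) (Q : nat -> state R -> Prop).

(** A weakest precondition whose postcondition also receives the running time, so that termination,
    result and cost are proved together. *)
Definition wp c Q s := exists t s', exec c s t s' /\ Q t s'.

Lemma wp_nassign v e Q s :
  Q (ncost e).+1 (set_nvar s v (neval s e)) -> wp (NAssign v e) Q s.
Proof. by do 2 eexists; split; first exact: ExecNAssign. Qed.

Lemma wp_nput a e1 e2 Q s :
  Q (ncost e1 + ncost e2).+1
    (set_narr s a [eta narr s a with neval s e1 |-> neval s e2]) ->
  wp (NPut a e1 e2) Q s.
Proof. by do 2 eexists; split; first exact: ExecNPut. Qed.

Lemma wp_rput a e1 e2 Q s :
  Q (ncost e1 + rcost e2).+1
    (set_rarr s a [eta rarr s a with neval s e1 |-> reval s e2]) ->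
  wp (RPut a e1 e2) Q s.
Proof. by do 2 eexists; split; first exact: ExecRPut. Qed.

Lemma wp_draw a w l Q s : src s = w :: l ->
  Q (size w).+1 (set_src (set_narr s a (fun k => nth (narr s a k) w k)) l) ->
  wp (Draw a) Q s.
Proof. by move=> sw q; do 2 eexists; split; [apply: ExecDraw sw|]. Qed.

Lemma wp_seq c1 c2 Q s :
  wp c1 (fun t1 s1 => wp c2 (fun t2 s2 => Q (t1 + t2)%N s2) s1) s ->
  wp (Seq c1 c2) Q s.
Proof.
move=> [t1 [s1 [E1 [t2 [s2 [E2 q]]]]]]; exists (t1 + t2)%N, s2; split=> //.
exact: ExecSeq E1 E2.
Qed.

Lemma wp_if b c1 c2 Q s :
  wp (if beval s b then c1 else c2) (fun t s' => Q (bcost b + t).+1 s') s ->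
  wp (If b c1 c2) Q s.
Proof. by move=> [t [s' [E q]]]; do 2 eexists; split; first exact: ExecIf E. Qed.

Lemma wp_weaken c Q1 Q2 s :
  (forall t s', Q1 t s' -> Q2 t s') -> wp c Q1 s -> wp c Q2 s.
Proof. by move=> QQ [t [s' [E /QQ q]]]; exists t, s'. Qed.

(** [Inv j] describes the state after [j] iterations. The test is charged with each of the [N] runs
    of the body and once more at the exit. *)
Lemma wp_while b c N B (Inv : nat -> state R -> Prop) Q s :
  Inv 0%N s ->
  (forall j s', (j < N)%N -> Inv j s' ->
     beval s' b /\ wp c (fun t s'' => (t <= B)%N /\ Inv j.+1 s'') s') ->
  (forall s', Inv N s' -> ~~ beval s' b) ->
  (forall t s', (t <= N * (B + bcost b).+1 + (bcost b).+1)%N -> Inv N s' ->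
     Q t s') ->
  wp (While b c) Q s.
Proof.
move=> Inv0 step stop post; set T := (B + bcost b).+1 in post *.
suff loop r j s1 : (j + r = N)%N -> Inv j s1 -> wp (While b c)
    (fun t s' => (t <= r * T + (bcost b).+1)%N /\ Inv N s') s1.
  by apply: wp_weaken (loop N 0%N s (add0n N) Inv0) => t s' [tB]; apply: post.
elim: r j s1 => [|r IH] j s1 jrN Invj.
  rewrite addn0 in jrN; rewrite jrN in Invj.
  by exists (bcost b).+1, s1; split; first by apply: ExecWhileEnd; apply: stop.
have [|bs [t1 [s2 [E1 [t1B Inv1]]]]] := step j s1 _ Invj; first by lia.
have [|t2 [s3 [E2 [t2B Inv2]]]] := IH j.+1 s2 _ Inv1; first by lia.
exists (bcost b + t1 + t2).+1, s3; split; first exact: ExecWhileStep bs E1 E2.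
by split=> //; rewrite mulSn /T; lia.
Qed.

Definition for_loop v e c :=
  Seq (NAssign v (NConst 0))
      (While (BNot (BNle e (NVar v)))
         (Seq c (NAssign v (NAdd (NVar v) (NConst 1))))).

(** The 8 consists of 4 for incrementing [v] and 4 for the test apart from [e]; the 6 consists of 2
    for resetting [v] and 4 for the last test. *)
Lemma wp_for_loop v e c N B (Inv : nat -> state R -> Prop) Q s :
  Inv 0%N (set_nvar s v 0) ->
  (forall j s', Inv j s' -> nvar s' v = j /\ neval s' e = N) ->
  (forall j s', (j < N)%N -> Inv j s' ->
     wp c (fun t s'' => (t <= B)%N /\ Inv j.+1 (set_nvar s'' v (nvar s'' v).+1)) s') ->
  (forall t s', (t <= N * (B + ncost e + 8) + (ncost e + 6))%N -> Inv N s' ->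
     Q t s') ->
  wp (for_loop v e c) Q s.
Proof.
move=> Inv0 InvE step post; apply: wp_seq; apply: wp_nassign => /=.
apply: (wp_while (N := N) (B := B + 4) Inv0) => [j s' jN Invj|s' InvN|t s' tB InvN] /=.
- have [-> ->] := InvE _ _ Invj; rewrite -ltnNge; split=> //.
  apply: wp_seq; apply: wp_weaken (step j s' jN Invj) => t s'' [tB Invj'].
  by apply: wp_nassign; split=> /=; [lia | rewrite addn1].
- by have [-> ->] := InvE _ _ InvN; rewrite leqnn.
- by apply: post => //; apply: leq_trans (leq_add (leqnn 2) tB) _ => /=; lia.
Qed.

End Wp.

(** * Frame conditions *)

Section Agree.
Variable R : Type.
Implicit Types (s : state R) (vs ars : seq nat).

(** The lists [vs] and [ars] name the variables and arrays of naturals that may have changed. *)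
Definition agree vs ars s s' :=
  [/\ forall v, v \notin vs -> nvar s' v = nvar s v, rvar s' = rvar s,
      forall a, a \notin ars -> narr s' a = narr s a, rarr s' = rarr s
    & src s' = src s].

Lemma agree_trans vs ars s1 s2 s3 :
  agree vs ars s1 s2 -> agree vs ars s2 s3 -> agree vs ars s1 s3.
Proof.
move=> [n12 r12 a12 ra12 s12] [n23 r23 a23 ra23 s23]; split; try congruence.
  by move=> v vvs; rewrite n23 ?n12.
by move=> a aars; rewrite a23 ?a12.
Qed.

Lemma agree_sub vs ars vs' ars' s s' : {subset vs <= vs'} -> {subset ars <= ars'} ->
  agree vs ars s s' -> agree vs' ars' s s'.
Proof.
move=> vv aa [nE rE aE raE sE]; split=> // [v vvs|a aars].
  by apply: nE; apply: contra vvs; apply: vv.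
by apply: aE; apply: contra aars; apply: aa.
Qed.

Lemma agree_set_nvar vs ars s s' v x : v \in vs ->
  agree vs ars s s' -> agree vs ars s (set_nvar s' v x).
Proof.
move=> vvs [nE rE aE raE sE]; split=> // w wvs /=.
by case: eqP wvs => [->|_ /nE //]; rewrite vvs.
Qed.

Lemma agree_set_narr vs ars s s' a f : a \in ars ->
  agree vs ars s s' -> agree vs ars s (set_narr s' a f).
Proof.
move=> aars [nE rE aE raE sE]; split=> // b bars /=.
by case: eqP bars => [->|_ /aE //]; rewrite aars.
Qed.

End Agree.

(* Variables: 3 = |Sigma|^d, 4 = number of samples drawn, 5 = vertex, 6 = inner
   loop counter, 7 = code of the parents (evaluated by Horner's rule from the
   most significant digit), 8 = block, 9 = cell. Arrays of naturals: 2 = current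
   sample, 3 and 4 = numbers of occurrences of the cells and of the blocks. *)
Definition power_cmd : cmd :=
  Seq (NAssign 3 (NConst 1))
      (for_loop 6 (NVar 2) (NAssign 3 (NMul (NVar 3) (NVar 1)))).

Definition code_cmd : cmd :=
  Seq (NAssign 7 (NConst 0))
      (for_loop 6 (NGet 0 (NVar 5))
         (NAssign 7
            (NAdd
               (NGet 2
                  (NGet 1
                     (NAdd (NMul (NVar 5) (NVar 2))
                           (NSub (NSub (NGet 0 (NVar 5)) (NConst 1)) (NVar 6)))))
               (NMul (NVar 1) (NVar 7))))).

Definition count_cmd : cmd :=
  Seq code_cmd
 (Seq (NAssign 8 (NAdd (NMul (NVar 5) (NVar 3)) (NVar 7)))
 (Seq (NPut 4 (NVar 8) (NAdd (NGet 4 (NVar 8)) (NConst 1)))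
 (Seq (NAssign 9 (NAdd (NMul (NVar 8) (NVar 1)) (NGet 2 (NVar 5))))
      (NPut 3 (NVar 9) (NAdd (NGet 3 (NVar 9)) (NConst 1)))))).

Definition more_samples : bexp :=
  BAnd (BNot (BRle (RNat (NConst 1)) (RVar 0)))
       (BNot (BRle
         (RNat (NMul (NConst 10) (NMul (NMul (NVar 3) (NVar 1)) (NVar 0))))
         (RMul (RNat (NVar 4)) (RMul (RVar 0) (RVar 0))))).

Definition sample_cmd : cmd :=
  Seq (NAssign 4 (NConst 0))
      (While more_samples
         (Seq (Draw 2)
         (Seq (NAssign 4 (NAdd (NVar 4) (NConst 1)))
              (for_loop 5 (NVar 0) count_cmd)))).

Definition cell_exp : nexp := NAdd (NMul (NVar 8) (NVar 1)) (NVar 6).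

Definition estimate_cmd : cmd :=
  for_loop 8 (NMul (NVar 0) (NVar 3))
    (for_loop 6 (NVar 1)
       (RPut 0 cell_exp
          (RDiv (RNat (NAdd (NGet 3 cell_exp) (NConst 1)))
                (RNat (NAdd (NGet 4 (NVar 8)) (NVar 1)))))).

(* For a one-letter alphabet the cost of computing 1^d is not within the
   allowed time, so this case is separated. *)
Definition learn_cmd : cmd :=
  If (BNle (NVar 1) (NConst 1))
     (for_loop 5 (NVar 0) (RPut 0 (NVar 5) (RNat (NConst 1))))
     (Seq power_cmd (Seq sample_cmd estimate_cmd)).

(** * Correctness and running time of the learner *)

Section Program.
Variables (R : realType) (n d : nat) (Sigma : finType) (eps : R).
Variable G : rel 'I_n.
Hypothesis pad : forall i, (#|parents G i| <= d)%N.
Implicit Types (s : state R) (x : assignment n Sigma) (i : 'I_n).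

Let k := #|Sigma|.
Let K := (k ^ d)%N.
Let s0 := init d eps G ([::] : seq (assignment n Sigma)).

(** The part of the initial state that the program never overwrites. *)
Definition input s :=
  [/\ [/\ nvar s 0 = n, nvar s 1 = k & nvar s 2 = d]%N, rvar s = rvar s0,
      narr s 0 = narr s0 0 & narr s 1 = narr s0 1].

Lemma agree_input vs ars s s' : agree vs ars s s' ->
  ~~ has (mem vs) [:: 0; 1; 2]%N -> ~~ has (mem ars) [:: 0; 1]%N ->
  input s -> input s'.
Proof.
move=> [nE rE aE _ _]; rewrite /= !negb_or => /and4P[v0 v1 v2 _] /and3P[a0 a1 _].
by move=> [[i0 i1 i2] i3 i4 i5]; split; rewrite ?nE ?rE ?aE.
Qed.

Lemma init_degree i : narr s0 0 i = #|parents G i|.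
Proof. by rewrite /s0 /= valK. Qed.

(** The in-degree bound gives [q < d], so [d] is positive and division by [d] recovers [i] and [q]
    from the address. *)
Lemma init_parent i q : (q < #|parents G i|)%N ->
  narr s0 1 (i * d + q) = nth i (enum (parents G i)) q.
Proof.
move=> qi; have qd := leq_trans qi (pad i).
have d0 : (0 < d)%N by lia.
rewrite /s0 /= divnMDl // divn_small // addn0 valK.
by rewrite modnMDl modn_small // (nth_map i) // -cardE.
Qed.

Lemma wp_power s (Q : nat -> state R -> Prop) : input s ->
  (forall t s', (t <= 20 * (d + 1))%N -> nvar s' 3 = K ->
     agree [:: 3; 6]%N [::] s s' -> Q t s') ->
  wp power_cmd Q s.
Proof.
move=> inp post; apply: wp_seq; apply: wp_nassign.
pose Inv j s' := [/\ nvar s' 6 = j, nvar s' 3 = (k ^ j)%N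
  & agree [:: 3; 6]%N [::] s s'].
apply: (@wp_for_loop _ _ _ _ d 4 Inv).
- by split=> //=; do 2 apply: agree_set_nvar => //.
- move=> j s' [v6 v3 ag]; split=> //=.
  by have [[_ _ ->]] := agree_input ag isT isT inp.
- move=> j s' jd [v6 v3 ag]; apply: wp_nassign; split=> //.
  have [[_ v1 _] _ _ _] := agree_input ag isT isT inp.
  split=> /=; [by rewrite v6 | by rewrite v3 v1 expnSr |].
  by do 2 apply: agree_set_nvar => //.
- by move=> t s' tB [_ v3 ag]; apply: post => //=; move: tB => /=; lia.
Qed.

Lemma wp_code i x s (Q : nat -> state R -> Prop) : input s -> nvar s 5 = i ->
  (forall j : 'I_n, narr s 2 j = enum_rank (x j)) ->
  (forall t s', (t <= 40 * (d + 1))%N ->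
     nvar s' 7 = code x (enum (parents G i)) ->
     agree [:: 6; 7]%N [::] s s' -> Q t s') ->
  wp code_cmd Q s.
Proof.
move=> inp v5 smp post; apply: wp_seq; apply: wp_nassign.
set ps := enum _ in post; have sz : size ps = #|parents G i| by rewrite -cardE.
(* After [j] rounds of Horner's rule, variable 7 holds the code of the last [j] parents. *)
pose Inv j s' := [/\ nvar s' 6 = j, nvar s' 7 = code x (drop (size ps - j) ps)
  & agree [:: 6; 7]%N [::] s s'].
have frame s' : agree [:: 6; 7]%N [::] s s' ->
    [/\ input s', nvar s' 5 = i & narr s' 2 = narr s 2].
  move=> ag; have inp' := agree_input ag isT isT inp.
  by case: ag => nE _ aE _ _; rewrite nE ?aE.
apply: (@wp_for_loop _ _ _ _ (size ps) 20 Inv).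
- by split=> //=; [rewrite subn0 drop_size | do 2 apply: agree_set_nvar => //].
- move=> j s' [v6 v7 /frame[[_ _ a0 _] v5' _]]; split=> //=.
  by rewrite a0 v5' init_degree sz.
- move=> j s' jd [v6 v7 ag]; apply: wp_nassign; split=> //.
  have [[[_ v1 v2] _ a0 a1] v5' a2] := frame _ ag.
  split=> /=; [by rewrite v6 | | by do 2 apply: agree_set_nvar => //].
  rewrite a2 a0 a1 v5' v2 v1 v6 v7 init_degree -sz.
  have -> : (size ps - 1 - j = size ps - j.+1)%N by lia.
  rewrite init_parent ?smp; last by rewrite -sz; lia.
  have lt : (size ps - j.+1 < size ps)%N by lia.
  rewrite -/ps [in RHS](drop_nth i lt) /=.
  by rewrite subnSK.
- move=> t s' tB [_ v7 ag]; apply: post => //.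
    by move: tB (pad i) => /=; rewrite -sz; move: (size ps) => q; lia.
  by rewrite v7 subnn drop0.
Qed.

Definition block i x := (i * K + code x (enum (parents G i)))%N.
(** This is the address that [output_cpt] reads, so counters and estimates share one layout. *)
Definition cell_of i x (a : Sigma) := (block i x * k + enum_rank a)%N.
Definition cell i x := cell_of i x (x i).

Lemma wp_count i x s (Q : nat -> state R -> Prop) :
  input s -> nvar s 3 = K -> nvar s 5 = i ->
  (forall j : 'I_n, narr s 2 j = enum_rank (x j)) ->
  (forall t s', (t <= 100 * (d + 1))%N ->
     (forall p, narr s' 3 p = narr s 3 p + (p == cell i x))%N ->
     (forall b, narr s' 4 b = narr s 4 b + (b == block i x))%N ->
     agree [:: 6; 7; 8; 9]%N [:: 3; 4]%N s s' -> Q t s') ->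
  wp count_cmd Q s.
Proof.
move=> inp v3 v5 smp post; apply: wp_seq; apply: (wp_code inp v5 smp).
move=> t s' tB v7 ag.
have [[_ v1 v2] _ a0 a1] := agree_input ag isT isT inp.
have [nE _ aE _ _] := ag.
apply: wp_seq; apply: wp_nassign; apply: wp_seq; apply: wp_nput.
apply: wp_seq; apply: wp_nassign; apply: wp_nput.
have blockE : (nvar s' 5 * nvar s' 3 + nvar s' 7 = block i x)%N.
  by rewrite v7 !nE // v3 v5.
have cellE : (block i x * nvar s' 1 + narr s' 2 (nvar s' 5) = cell i x)%N.
  by rewrite v1 nE // aE // v5 smp.
apply: post => [|p|b|] /=.
- by move: tB; lia.
- by rewrite blockE cellE aE //; case: eqP => [->|_]; rewrite ?addn0.
- by rewrite blockE aE //; case: eqP => [->|_]; rewrite ?addn0.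
apply: agree_set_narr => //; apply: agree_set_nvar => //.
apply: agree_set_narr => //; apply: agree_set_nvar => //.
by apply: agree_sub ag => // v; rewrite !inE => /orP[]->; rewrite ?orbT.
Qed.

(** One array of counters serves all vertices, hence the sum over [i]; [counts_count] later isolates
    the only vertex that can address [p]. *)
Definition counts (f : 'I_n -> assignment n Sigma -> nat)
    (xs : seq (assignment n Sigma)) (p : nat) : nat :=
  (\sum_(x <- xs) \sum_i (p == f i x))%N.

Lemma wp_count_all x xs s (Q : nat -> state R -> Prop) :
  input s -> nvar s 3 = K ->
  (forall j : 'I_n, narr s 2 j = enum_rank (x j)) ->
  narr s 3 =1 counts cell xs -> narr s 4 =1 counts block xs ->
  (forall t s', (t <= 120 * (n * (d + 1) + 1))%N ->
     narr s' 3 =1 counts cell (rcons xs x) ->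
     narr s' 4 =1 counts block (rcons xs x) ->
     agree [:: 5; 6; 7; 8; 9]%N [:: 3; 4]%N s s' -> Q t s') ->
  wp (for_loop 5 (NVar 0) count_cmd) Q s.
Proof.
move=> inp v3 smp a3 a4 post.
(* The counters while the current sample is processed: the earlier samples in full, the current one
   for the vertices below [j]. *)
pose part f p j := (counts f xs p + \sum_(i < n | (i < j)%N) (p == f i x))%N.
pose Inv j s' := [/\ nvar s' 5 = j, forall p, narr s' 3 p = part cell p j,
  forall p, narr s' 4 p = part block p j
  & agree [:: 5; 6; 7; 8; 9]%N [:: 3; 4]%N s s'].
have partS f p i : (part f p i.+1 = part f p i + (p == f i x))%N.
  rewrite /part -addnA; congr (_ + _)%N.
  rewrite (bigD1 i) //= addnC; congr (_ + _)%N; apply: eq_bigl => j.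
  by rewrite ltnS ltn_neqAle andbC.
have part0 f p : part f p 0%N = counts f xs p by rewrite /part big_pred0_eq addn0.
apply: (@wp_for_loop _ _ _ _ n (100 * (d + 1)) Inv).
- split=> // [p|p|] /=; [by rewrite part0 a3|by rewrite part0 a4|].
  exact: agree_set_nvar.
- move=> j s' [v5 _ _ ag]; split=> //=.
  by have [[-> _ _]] := agree_input ag isT isT inp.
- move=> j s' jn [v5 a3' a4' ag]; pose i := Ordinal jn.
  have inp' := agree_input ag isT isT inp; have [nE _ aE _ _] := ag.
  apply: (@wp_count i x) => //; first by rewrite nE.
    by move=> j'; rewrite aE.
  move=> t s'' tB a3'' a4'' ag'; split=> //; split=> /= [|p|p|].
  + by case: ag' => ->; rewrite ?v5.
  + by rewrite a3'' a3' (partS _ _ i).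
  + by rewrite a4'' a4' (partS _ _ i).
  + apply: agree_set_nvar => //; apply: agree_trans ag _.
    by apply: agree_sub ag' => // v vin; rewrite inE vin orbT.
- have partn f p : part f p n = counts f (rcons xs x) p.
    rewrite /counts -cats1 big_cat big_seq1; congr (_ + _)%N.
    by apply: eq_bigl => i; rewrite ltn_ord.
  move=> t s' tB [_ a3' a4' ag]; apply: post => //.
  + by move: tB => /=; nia.
  + by move=> p; rewrite a3' partn.
  + by move=> p; rewrite a4' partn.
Qed.

Lemma nth_encode_sample x (j : 'I_n) y0 :
  nth y0 (encode_sample x) j = enum_rank (x j).
Proof.
by rewrite /encode_sample (nth_map j) ?size_enum_ord // nth_ord_enum.
Qed.

(** The value of the test [more_samples] after [m] draws. It ignores the drawn values, so the sample
    size is fixed in advance. *)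
Definition undersampled (m : nat) : bool :=
  ~~ (1 <= eps) && ~~ ((10 * (K * k * n))%:R <= m%:R * (eps * eps)).

(** The hypotheses on [undersampled] make the loop draw exactly the samples in [xs]: no draw gets
    stuck and none is left over. *)
Lemma wp_sample xs s (Q : nat -> state R -> Prop) :
  input s -> nvar s 3 = K -> narr s 3 =1 (fun=> 0%N) -> narr s 4 =1 (fun=> 0%N) ->
  src s = [seq encode_sample x | x <- xs] ->
  (forall j, (j < size xs)%N -> undersampled j) -> ~~ undersampled (size xs) ->
  (forall t s', (t <= 160 * (size xs * (n * (d + 1) + 1) + 1))%N ->
     input s' -> nvar s' 3 = K -> narr s' 3 =1 counts cell xs ->
     narr s' 4 =1 counts block xs -> src s' = [::] -> Q t s') ->
  wp sample_cmd Q s.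
Proof.
move=> inp v3 a3 a4 srcs under enough post; apply: wp_seq; apply: wp_nassign.
pose Inv j s' := [/\ input s', nvar s' 3 = K /\ nvar s' 4 = j,
  narr s' 3 =1 counts cell (take j xs), narr s' 4 =1 counts block (take j xs)
  & src s' = [seq encode_sample x | x <- drop j xs]].
have more j s' : Inv j s' -> beval s' more_samples = undersampled j.
  by move=> [[[i0 i1 _] i3 _ _] [v3' v4'] _ _ _] /=; rewrite i0 i1 i3 v3' v4'.
apply: (@wp_while _ _ _ (size xs) (130 * (n * (d + 1) + 1)) Inv).
- split=> //= [p|p|]; last by rewrite drop0.
    by rewrite a3 take0 /counts big_nil.
  by rewrite a4 take0 /counts big_nil.
- move=> j s' jxs invj; split; first by rewrite (more j) ?under.
  have [inp' [v3' v4'] a3' a4' srcs'] := invj.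
  case dropE : (drop j xs) srcs' => [|x l] /= srcs'.
    by have := size_drop j xs; rewrite dropE /=; lia.
  have takeE : take j.+1 xs = rcons (take j xs) x.
    by rewrite -addn1 takeD dropE /= take0 cats1.
  have lE : drop j.+1 xs = l by rewrite -add1n -drop_drop dropE /= drop0.
  apply: wp_seq; apply: wp_draw srcs' _; apply: wp_seq; apply: wp_nassign.
  apply: (@wp_count_all x (take j xs)) => //=.
    by move=> j'; rewrite nth_encode_sample.
  move=> t s'' tB a3'' a4'' ag; split.
    by rewrite /encode_sample size_map size_enum_ord; nia.
  split; rewrite ?takeE ?lE //.
  + exact: agree_input ag _ _ inp'.
  + by case: ag => nE _ _ _ _; rewrite !nE //= v4' addn1.
  + by case: ag => _ _ _ _ ->.
- by move=> s' /more ->.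
- move=> t s' tB [inp' [v3' _] a3' a4' srcs'].
  apply: post => //; first by move: tB => /=; nia.
  + by move=> p; rewrite a3' take_size.
  + by move=> p; rewrite a4' take_size.
  + by rewrite srcs' drop_size.
Qed.

Lemma wp_estimate s (Q : nat -> state R -> Prop) : (0 < k)%N ->
  input s -> nvar s 3 = K ->
  (forall t s', (t <= 70 * (n * K * k + 1))%N ->
     (forall p, (p < n * K * k)%N -> rarr s' 0 p =
        (narr s 3 p).+1%:R / (narr s 4 (p %/ k) + k)%:R) ->
     src s' = src s -> Q t s') ->
  wp estimate_cmd Q s.
Proof.
move=> k0 [[v0 v1 _] _ _ _] v3 post.
pose val p : R := (narr s 3 p).+1%:R / (narr s 4 (p %/ k) + k)%:R.
pose base s' := [/\ nvar s' 0 = n, nvar s' 1 = k, nvar s' 3 = K,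
  narr s' = narr s & src s' = src s]%N.
pose Inv b s' := [/\ base s', nvar s' 8 = b
  & forall p, (p < b * k)%N -> rarr s' 0 p = val p].
apply: (@wp_for_loop _ _ _ _ (n * K) (30 * k + 7) Inv) => //.
- by move=> b s' [[v0' _ v3' _ _] v8 _] /=; rewrite v0' v3' v8.
- move=> b s1 bn [base1 v8 filled].
  (* The nested loops fill the cells in increasing order of address. *)
  pose Inv' a s' := [/\ base s', nvar s' 8 = b, nvar s' 6 = a
    & forall p, (p < b * k + a)%N -> rarr s' 0 p = val p].
  apply: (@wp_for_loop _ _ _ _ k 21 Inv').
  + by split=> // p; rewrite addn0 => /filled.
  + by move=> a s' [[_ v1' _ _ _] _ v6 _] /=; rewrite v1' v6.
  + move=> a s' ak [base' v8' v6 filled']; have [v0' v1' v3' aE _] := base'.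
    apply: wp_rput; split=> //; split=> //= [|p]; first by rewrite v6.
    rewrite v8' v1' v6 aE addnS ltnS leq_eqVlt.
    case: eqP => [-> _|_ /= /filled' //].
    by rewrite addn1 /val divnMDl // divn_small // addn0.
  + move=> t s' tB [base' v8' _ filled']; split; first by move: tB => /=; lia.
    by split=> //= [|p]; rewrite ?v8' // mulSn addnC => /filled'.
- move=> t s' tB [[_ _ _ _ srcE] _ filled]; apply: post => //.
  by move: tB => /=; nia.
Qed.

Lemma mul_addn_eq q u v a b : (a < q)%N -> (b < q)%N ->
  (u * q + a == v * q + b)%N = (u == v) && (a == b).
Proof.
move=> aq bq; have q0 : (0 < q)%N by lia.
apply/eqP/andP => [E|[/eqP-> /eqP->] //].
have := congr1 (divn^~ q) E; have := congr1 (modn^~ q) E => /=.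
by rewrite !modnMDl !divnMDl // !modn_small // !divn_small // !addn0 => -> ->.
Qed.

Lemma code_parents_lt i x : (code x (enum (parents G i)) < K)%N.
Proof.
have k0 := card_alphabet_gt0 x i.
by apply: leq_trans (code_lt _ _) _; rewrite -cardE leq_pexp2l.
Qed.

Lemma counts_count f xs p i (A : pred (assignment n Sigma)) :
  (forall j y, (p == f j y) = (i == j) && A y) -> counts f xs p = count A xs.
Proof.
move=> fE; rewrite /counts -sum1_count [RHS]big_mkcond /=; apply: eq_bigr => y _.
rewrite (bigD1 i) //= fE eqxx /= big1 ?addn0 => [|j]; first by case: (A y).
by rewrite fE eq_sym => /negbTE->.
Qed.

Lemma block_eq i x j y :
  (block i x == block j y) = (i == j) && (y \in cyl (parents G i) x).
Proof.
rewrite mul_addn_eq ?code_parents_lt // -val_eqE /=.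
by case: eqP => //= /val_inj <-; rewrite eq_sym code_cyl.
Qed.

Lemma cell_eq i x a j y : (cell_of i x a == cell j y) =
  (i == j) && ((y \in cyl (parents G i) x) && (y i == a)).
Proof.
rewrite mul_addn_eq // block_eq -andbA; case: eqP => //= <-; congr (_ && _).
by rewrite val_eqE (inj_eq enum_rank_inj) eq_sym.
Qed.

Lemma cell_lt i x a : (cell_of i x a < n * K * k)%N.
Proof.
have b_lt : (block i x < n * K)%N.
  by rewrite /block; have := code_parents_lt i x; have := ltn_ord i; nia.
by rewrite /cell_of; have := ltn_ord (enum_rank a); rewrite -/k; nia.
Qed.

(** The maximum with 1 in the time bound pays for filling the table when no sample is drawn. *)
Lemma wp_learn xs : (0 < n)%N -> (0 < k)%N -> ((k <= 1)%N -> xs = [::]) ->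
  ((1 < k)%N -> (forall j, (j < size xs)%N -> undersampled j) /\
     ~~ undersampled (size xs)) ->
  wp learn_cmd (fun t s' =>
    [/\ src s' = [::], (t <= 1000 * (k ^ d.+1 * maxn (size xs) 1 * n))%N
      & forall i x a, output_cpt (Sigma := Sigma) d G s' i x a = laplace R G xs i x a])
    (init d eps G xs).
Proof.
move=> n0 k0 single multi; set X := (k ^ d.+1 * _ * n)%N.
have inp : input (init d eps G xs) by [].
apply: wp_if => /=; rewrite -/k; case: ifP => [k1|/negbT k1].
- have kE : k = 1%N by lia.
  pose Inv j s' := [/\ nvar s' 0 = n, nvar s' 5 = j, src s' = [::]
    & forall p, (p < j)%N -> rarr s' 0 p = 1%R]%N.
  apply: (@wp_for_loop _ _ _ _ n 5 Inv) => //.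
  + by split=> //; rewrite /= single.
  + by move=> j s' [v0 v5 _ _] /=; rewrite v0.
  + move=> j s' jn [v0 v5 srcE filled]; apply: wp_rput; split=> //.
    split=> //= [|p]; first by rewrite v5.
    by rewrite v5 ltnS leq_eqVlt; case: eqP => //= _ /filled.
  + move=> t s' tB [_ _ srcE filled]; split=> //.
      have nX : (n <= X)%N by rewrite /X kE exp1n mul1n; nia.
      by move: tB nX n0 => /=; move: X => X; lia.
    (* With one letter and no samples every estimate is [1 / 1], and the table has just [n]
       cells. *)
    move=> i x a; rewrite single // /laplace /= add0n -/k kE divr1.
    apply: filled; have := cell_lt i x a; rewrite /cell_of /block /K.
    by move: (nat_of_ord (enum_rank a)) => r; rewrite -/k kE exp1n !muln1.
- rewrite -ltnNge in k1; have [under enough] := multi k1.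
  apply: wp_seq; apply: wp_power => // t1 s1 t1B v3 ag1.
  have inp1 := agree_input ag1 isT isT inp.
  have [_ _ a1E _ src1] := ag1.
  apply: wp_seq; apply: (wp_sample inp1 v3 _ _ src1 under enough).
  + by move=> p; rewrite a1E.
  + by move=> p; rewrite a1E.
  move=> t2 s2 t2B inp2 v3' a3 a4 src2.
  apply: wp_estimate => // t3 s3 t3B filled src3.
  split; first by rewrite src3.
    (* As [k >= 2], the factor [d + 1] spent on each vertex of a sample is absorbed by [k ^ d]. *)
    have dK : (d < K)%N by apply: ltn_expl.
    pose M := maxn (size xs) 1.
    have XE : X = (K * k * M * n)%N by rewrite /X expnSr.
    have M1 : (1 <= M)%N by rewrite leq_max orbT.
    have mM : (size xs <= M)%N by rewrite leq_max leqnn.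
    have X1 : (d + 1 <= X)%N.
      by rewrite addn1 XE -!mulnA (leq_trans dK) // leq_pmulr // !muln_gt0 k0 M1.
    have X2 : (size xs * (n * (d + 1) + 1) + 1 <= 3 * X)%N.
      apply: (@leq_trans (M * (n * (d + 1) + 1) + 1)).
        by rewrite leq_add2r leq_mul2r mM orbT.
      apply: (@leq_trans (3 * (M * n * K))); first by nia.
      have -> : X = (M * n * K * k)%N by rewrite XE; lia.
      by rewrite leq_mul2l leq_pmulr.
    have X3 : (n * K * k + 1 <= 2 * X)%N.
      apply: (@leq_trans (2 * (n * K * k))); first by nia.
      have -> : X = (n * K * k * M)%N by rewrite XE; lia.
      by rewrite leq_mul2l leq_pmulr.
    clearbody X; clear XE; move: t1B t2B t3B X1 X2 X3; move: (size xs * _)%N (n * K * k)%N.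
    by lia.
  move=> i x a; rewrite /output_cpt -/k -/K -/(block i x) -/(cell_of i x a).
  rewrite filled ?cell_lt // a3 a4.
  rewrite (counts_count _ (cell_eq i x a)).
  rewrite /cell_of divnMDl // divn_small // addn0.
  by rewrite (counts_count _ (block_eq i x)).
Qed.
End Program.

(** * The number of samples *)

Lemma ln_nat_ge_half (R : realType) (N : nat) : (2 <= N)%N -> 2^-1 <= ln N%:R :> R.
Proof.
(* This follows from [exp (- 1/2) >= 1 - 1/2] by taking inverses. *)
move=> N2; have e2 : expR 2^-1 <= 2 :> R.
  have := expR_ge1Dx (- 2^-1 : R); rewrite expRN => H.
  have e0 := expR_gt0 (2^-1 : R).
  have : 2^-1 <= (expR 2^-1)^-1 :> R by lra.
  by rewrite lef_pV2 ?posrE.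
rewrite -[leLHS]expRK ler_ln ?posrE ?expR_gt0 ?ltr0n //; last by lia.
by apply: le_trans e2 _; rewrite ler_nat.
Qed.

(** In the main case [m] is the least number of draws that fails the loop test, so a positive [m]
    satisfies [(m - 1) * eps^2 < 10 * N]. As [eps < 1] and [N >= 2], the rounding costs at most 1,
    and [ln N >= 1/2] brings in the logarithm. *)
Lemma sample_size (R : realType) (n d : nat) (Sigma : finType) (eps : R)
    (N := (#|Sigma| ^ d.+1 * n)%N) :
  (0 < n)%N -> 0 < eps ->
  exists m : nat,
    [/\ m%:R <= 1000%:R * (N%:R * ln N%:R * eps ^- 2),
        (#|Sigma| <= 1)%N -> m = 0%N,
        (1 < #|Sigma|)%N ->
          (forall j, (j < m)%N -> undersampled n d Sigma eps j) /\
          ~~ undersampled n d Sigma eps m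
      & 10 * N%:R <= m%:R * eps ^+ 2 \/ (#|Sigma| <= 1)%N \/ 1 <= eps].
Proof.
move=> n0 eps0; have e2 : 0 < eps ^+ 2 by rewrite exprn_gt0.
have NE : (#|Sigma| ^ d * #|Sigma| * n)%N = N by rewrite -expnSr.
have bound0 : 0%:R <= 1000%:R * (N%:R * ln N%:R * eps ^- 2).
  rewrite !mulr_ge0 ?invr_ge0 ?(ltW e2) //.
  (* An empty alphabet gives [N = 0], where [ln] takes the default value 0. *)
  by case: N {NE} => [|N']; [rewrite ln0 | rewrite ln_ge0 // ler1n].
(* With one letter and one vertex [N * ln N] is 0, so [m = 0] is forced. *)
have [S1|S2] := leqP #|Sigma| 1.
  by exists 0%N; split=> //; right; left.
have [eps1|eps1] := leP 1 eps.
  by exists 0%N; split=> // [_|]; [rewrite /undersampled eps1 | right; right].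
have ex : exists j, ~~ undersampled n d Sigma eps j.
  exists (Num.bound (10 * N%:R / eps ^+ 2)); rewrite /undersampled NE -expr2.
  rewrite negb_and !negbK natrM -ler_pdivrMr //; apply/orP; right.
  by apply/ltW/archi_boundP; rewrite divr_ge0 ?mulr_ge0 // ltW.
case: (ex_minnP ex) => m enough least; exists m.
have under j : (j < m)%N -> undersampled n d Sigma eps j.
  by move=> jm; apply: contraLR jm => /least; rewrite -leqNgt.
have N2 : (2 <= N)%N.
  apply: (@leq_trans (#|Sigma| ^ d.+1)); last by rewrite leq_pmulr.
  by rewrite expnS (leq_trans S2) // leq_pmulr // expn_gt0 (ltnW S2).
split=> //; last first.
  left; move: enough; rewrite /undersampled NE -expr2 negb_and !negbK natrM.
  by rewrite leNgt eps1.
have half := ln_nat_ge_half R N2.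
have NR2 : 2 <= N%:R :> R by rewrite ler_nat.
rewrite mulrA ler_pdivlMr //; case: m {enough least} under => [|m] under.
  by rewrite mul0r !mulr_ge0 //; lra.
have /andP[_] := under m (leqnn _).
rewrite NE -expr2 -ltNge natrM -[m.+1%:R]natr1 [leLHS]mulrDl mul1r => small.
have e1 : eps ^+ 2 <= 1 by rewrite expr_le1 // ltW.
have : N%:R * 2^-1 <= N%:R * ln N%:R :> R by rewrite ler_wpM2l.
move: small; move: (m%:R * _) (N%:R * ln _) => u v small.
by lra.
Qed.

Theorem theorem4p2 :
  exists (prog : cmd) (C : nat),
  forall (R : realType) (n d : nat) (Sigma : finType) (eps : R),
    (0 < n)%N -> 0 < eps ->
    let N := (#|Sigma| ^ d.+1 * n)%N in
    exists m : nat,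
      m%:R <= C%:R * (N%:R * ln N%:R * eps ^- 2) /\
      forall (G : rel 'I_n) (P : assignment n Sigma -> R),
        acyclic G ->
        (forall i : 'I_n, (#|parents G i| <= d)%N) ->
        bayes_net G P ->
        exists out : m.-tuple (assignment n Sigma) -> state R,
          let Phat (s : m.-tuple (assignment n Sigma)) :=
            cpt_law (output_cpt (Sigma := Sigma) d G (out s)) in
          [/\ forall s : m.-tuple (assignment n Sigma),
                exists t : nat,
                  [/\ exec prog (init d eps G s) t (out s),
                      src (out s) = [::]
                    & (t <= C * (#|Sigma| ^ d.+1 * maxn m 1 * n))%N],
              forall s : m.-tuple (assignment n Sigma),
                is_cpt (output_cpt (Sigma := Sigma) d G (out s)) /\
                bayes_net G (Phat s)
            & 9 / 10 <= prob (iid P (m := m))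
                          [set s : m.-tuple (assignment n Sigma) |
                             dTV P (Phat s) <= eps]].
Proof.
exists learn_cmd, 1000%N => R n d Sigma eps n0 eps0 N.
have [m [m_le m_single m_multi m_enough]] := @sample_size R n d Sigma eps n0 eps0.
exists m; split=> // G P acyG pad PG.
have [x0] := distr_inhabited PG; have S0 := card_alphabet_gt0 x0 (Ordinal n0).
have run (s : m.-tuple (assignment n Sigma)) : exists s', exists t,
    [/\ exec learn_cmd (init d eps G s) t s', src s' = [::],
        (t <= 1000 * (#|Sigma| ^ d.+1 * maxn m 1 * n))%N
      & output_cpt d G s' = laplace R G s].
  have [S1||t [s' [E [srcE tB outE]]]] :=
    @wp_learn R n d Sigma eps G pad s n0 S0.
  - by apply: size0nil; rewrite size_tuple m_single.
  - by rewrite size_tuple.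
  exists s', t; rewrite size_tuple in tB; split=> //.
  by do 3 apply: boolp.funext => ?; apply: outE.
(* Choice collects the final states of the runs, one for each tuple of samples, into a function. *)
have [out outP] := boolp.choice run; exists out => Phat.
have PhatE s : Phat s = cpt_law (laplace R G s).
  by case: (outP s) => t [_ _ _ E]; rewrite /Phat E.
split=> [s|s|].
- by have [t [E srcE tB _]] := outP s; exists t.
- split; last by rewrite PhatE; apply: laplace_bayes_net x0.
  by case: (outP s) => t [_ _ _ ->]; apply: laplace_cpt.
- under eq_finset do rewrite PhatE.
  exact: laplace_accuracy m_enough.
Qed.
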